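(* Let $p\ge 3$ be a prime, and let $N$ be a positive integer which is not divisible by $p$ such that $pN\equiv 3\pmod 8$. Let $\alpha$ be any nonnegative integer. (1) If $p\equiv 1\pmod 5$, then \[\mathrm{pod}\Big(\frac{5p^{10\alpha+9}N+1}{8}\Big)\equiv 0\pmod 5.\] (2) If $p\equiv 2,3,4\pmod 5$, then \[\mathrm{pod}\Big(\frac{5p^{8\alpha+7}N+1}{8}\Big)\equiv 0\pmod 5.\]
   Context: For an integer $n\ge 0$, $\mathrm{pod}(n)$ denotes the number of partitions of $n$ in which the odd parts are distinct (even parts may repeat); equivalently $\sum_{n\ge 0}\mathrm{pod}(n)q^n=\prod_{i\ge 1}\frac{1+q^{2i-1}}{1-q^{2i}}$. *)

(* Defs.v *)
From mathcomp Require Import all_boot.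

Set Implicit Arguments.
Unset Strict Implicit.
Unset Printing Implicit Defensive.

(* A partition of [n] is encoded by its multiplicities: [m i] is the number of
   parts equal to [i.+1].  Parts and multiplicities of a partition of [n] never
   exceed [n], so the bounds in the types exclude no partition. *)
Definition partition_mult (n : nat) := {ffun 'I_n -> 'I_n.+1}.

Definition is_partition (n : nat) (m : partition_mult n) : bool :=
  \sum_(i < n) m i * i.+1 == n.

Definition odd_parts_distinct (n : nat) (m : partition_mult n) : bool :=
  [forall i : 'I_n, odd i.+1 ==> (m i <= 1)].

Definition pod (n : nat) : nat :=
  #|[set m : partition_mult n | is_partition m && odd_parts_distinct m]|.

(* Main.v *)
(** Since the generating function of [(-1)^n pod(n)] is the inverse of
    [psi = sum_n q^(n(n+1)/2)] (Gauss, here through a finite identity of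
    Shanks), it is [psi^4 / psi(q^5)] modulo 5.  Splitting [psi] by exponents
    modulo 5 and multiplying by [2 + i] in [Z[i]] shows that the terms of
    [psi^4] with exponent 2 modulo 5 again form [psi^4] modulo 5; hence
    [pod(5m+2)] is [+-psi^3], that is [+-2 r3(8m+3)], modulo 5.

    The Hecke relation [r3(p^2 n) + p r3(n/p^2) = (p+1) r3(n)] for [p | n]
    comes from counting the pairs [(a, b)] of an integral quaternion [a] of
    norm [p] and a pure quaternion [b] of norm [n] through [a b conj(a)].  It
    gives [r3(p^(2k+1) N) = (1 + p + ... + p^k) r3(pN)], and the exponents of
    the statement are those for which 5 divides this geometric sum. *)
From HB Require Import structures.
Require Import Defs.
From mathcomp Require Import all_boot all_order all_algebra.
From mathcomp Require Import zify ring lra.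

Set Implicit Arguments.
Unset Strict Implicit.
Unset Printing Implicit Defensive.

Import Order.TTheory GRing.Theory Num.Theory.
Local Open Scope ring_scope.

(** * Quaternions over a commutative ring *)

(** Quaternions with integer coordinates have no unique factorization. What is needed of it is
    local: for a nonzero isotropic pure [g] modulo [p], the integral quaternions [x] with [g x = 0]
    modulo [p] form a right ideal. A descent inside this ideal reaches norm [p], and its elements of
    norm [p] are then one orbit of the 8 units. The number [8(p + 1)] of quaternions of norm [p] is
    obtained by counting them against the [p^2 - 1] nonzero isotropic pure quaternions modulo [p]. A
    pure [g] of norm [p^2 n] arises as [a b conj(a)] from 8 pairs, or from [8(p + 1)] pairs when
    [p^2] divides it. The condition [p | n] makes [g], and also [g / p] when it is integral,
    isotropic modulo [p], so that no Legendre symbol enters. *)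

Record quat (R : Type) := Quat { q0 : R; q1 : R; q2 : R; q3 : R }.

Definition quat_tuple (R : Type) (x : quat R) := (q0 x, q1 x, q2 x, q3 x).
Definition tuple_quat (R : Type) (t : R * R * R * R) :=
  let: (a, b, c, d) := t in Quat a b c d.
Lemma quat_tupleK (R : Type) : cancel (@quat_tuple R) (@tuple_quat R).
Proof. by case. Qed.

HB.instance Definition _ (R : eqType) :=
  Equality.copy (quat R) (can_type (@quat_tupleK R)).
HB.instance Definition _ (R : choiceType) :=
  Choice.copy (quat R) (can_type (@quat_tupleK R)).
HB.instance Definition _ (R : countType) :=
  Countable.copy (quat R) (can_type (@quat_tupleK R)).
HB.instance Definition _ (R : finType) :=
  Finite.copy (quat R) (can_type (@quat_tupleK R)).

Section QuatRing.
Variable R : comPzRingType.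
Implicit Types x y z : quat R.

Definition addq x y :=
  Quat (q0 x + q0 y) (q1 x + q1 y) (q2 x + q2 y) (q3 x + q3 y).
Definition oppq x := Quat (- q0 x) (- q1 x) (- q2 x) (- q3 x).
Definition mulq x y := Quat
  (q0 x * q0 y - q1 x * q1 y - q2 x * q2 y - q3 x * q3 y)
  (q0 x * q1 y + q1 x * q0 y + q2 x * q3 y - q3 x * q2 y)
  (q0 x * q2 y - q1 x * q3 y + q2 x * q0 y + q3 x * q1 y)
  (q0 x * q3 y + q1 x * q2 y - q2 x * q1 y + q3 x * q0 y).
Definition scalq (a : R) := Quat a 0 0 0.

Lemma quatP x y :
  q0 x = q0 y -> q1 x = q1 y -> q2 x = q2 y -> q3 x = q3 y -> x = y.
Proof. by case: x y => [? ? ? ?] [? ? ? ?] /= -> -> -> ->. Qed.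

Fact addqA : associative addq.
Proof. by move=> x y z; apply: quatP; rewrite /= addrA. Qed.
Fact addqC : commutative addq.
Proof. by move=> x y; apply: quatP; rewrite /= addrC. Qed.
Fact add0q : left_id (scalq 0) addq.
Proof. by move=> x; apply: quatP; rewrite /= add0r. Qed.
Fact addNq : left_inverse (scalq 0) oppq addq.
Proof. by move=> x; apply: quatP; rewrite /= addNr. Qed.
Fact mulqA : associative mulq.
Proof. by move=> x y z; apply: quatP => /=; ring. Qed.
Fact mul1q : left_id (scalq 1) mulq.
Proof. by move=> x; apply: quatP => /=; ring. Qed.
Fact mulq1 : right_id (scalq 1) mulq.
Proof. by move=> x; apply: quatP => /=; ring. Qed.
Fact mulqDl : left_distributive mulq addq.
Proof. by move=> x y z; apply: quatP => /=; ring. Qed.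
Fact mulqDr : right_distributive mulq addq.
Proof. by move=> x y z; apply: quatP => /=; ring. Qed.

End QuatRing.

HB.instance Definition _ (R : comPzRingType) := GRing.isPzRing.Build (quat R)
  (@addqA R) (@addqC R) (@add0q R) (@addNq R)
  (@mulqA R) (@mul1q R) (@mulq1 R) (@mulqDl R) (@mulqDr R).

Section QuatTheory.
Variable R : comPzRingType.
Implicit Types (x y z : quat R) (a b : R).

Definition conjq x := Quat (q0 x) (- q1 x) (- q2 x) (- q3 x).
Definition normq x := q0 x ^+ 2 + q1 x ^+ 2 + q2 x ^+ 2 + q3 x ^+ 2.

Lemma q0_mul x y :
  q0 (x * y) = q0 x * q0 y - q1 x * q1 y - q2 x * q2 y - q3 x * q3 y.
Proof. by []. Qed.
Lemma q1_mul x y :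
  q1 (x * y) = q0 x * q1 y + q1 x * q0 y + q2 x * q3 y - q3 x * q2 y.
Proof. by []. Qed.
Lemma q2_mul x y :
  q2 (x * y) = q0 x * q2 y - q1 x * q3 y + q2 x * q0 y + q3 x * q1 y.
Proof. by []. Qed.
Lemma q3_mul x y :
  q3 (x * y) = q0 x * q3 y + q1 x * q2 y - q2 x * q1 y + q3 x * q0 y.
Proof. by []. Qed.
Lemma q0_add x y : q0 (x + y) = q0 x + q0 y. Proof. by []. Qed.
Lemma q1_add x y : q1 (x + y) = q1 x + q1 y. Proof. by []. Qed.
Lemma q2_add x y : q2 (x + y) = q2 x + q2 y. Proof. by []. Qed.
Lemma q3_add x y : q3 (x + y) = q3 x + q3 y. Proof. by []. Qed.
Lemma q0_opp x : q0 (- x) = - q0 x. Proof. by []. Qed.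
Lemma q1_opp x : q1 (- x) = - q1 x. Proof. by []. Qed.
Lemma q2_opp x : q2 (- x) = - q2 x. Proof. by []. Qed.
Lemma q3_opp x : q3 (- x) = - q3 x. Proof. by []. Qed.
Lemma quat0E : 0 = Quat 0 0 0 0 :> quat R. Proof. by []. Qed.
Lemma quat1E : 1 = Quat 1 0 0 0 :> quat R. Proof. by []. Qed.

Definition quatE := (q0_mul, q1_mul, q2_mul, q3_mul, q0_add, q1_add, q2_add,
  q3_add, q0_opp, q1_opp, q2_opp, q3_opp, quat0E, quat1E).

Lemma conjqK : involutive conjq.
Proof. by move=> x; apply: quatP; rewrite /= ?opprK. Qed.
Lemma conjqM x y : conjq (x * y) = conjq y * conjq x.
Proof. by apply: quatP; rewrite ?quatE /=; ring. Qed.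
Lemma conjqN x : conjq (- x) = - conjq x.
Proof. by apply: quatP; rewrite ?quatE /=; ring. Qed.
Lemma conjq0 : conjq 0 = 0.
Proof. by apply: quatP; rewrite ?quatE /=; ring. Qed.
Lemma mulq_conj x : x * conjq x = scalq (normq x).
Proof. by apply: quatP; rewrite /normq ?quatE /=; ring. Qed.
Lemma conj_mulq x : conjq x * x = scalq (normq x).
Proof. by apply: quatP; rewrite /normq ?quatE /=; ring. Qed.
Lemma normqM x y : normq (x * y) = normq x * normq y.
Proof. by rewrite /normq !quatE; ring. Qed.
Lemma normq_conj x : normq (conjq x) = normq x.
Proof. by rewrite /normq /=; ring. Qed.
Lemma normq_scal a : normq (scalq a) = a ^+ 2.
Proof. by rewrite /normq /=; ring. Qed.
Lemma normq0 : normq 0 = 0.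
Proof. by rewrite /normq /=; ring. Qed.
Lemma scalqC a x : scalq a * x = x * scalq a.
Proof. by apply: quatP; rewrite ?quatE /=; ring. Qed.
Lemma scalqM a b : scalq (a * b) = scalq a * scalq b.
Proof. by apply: quatP; rewrite ?quatE /=; ring. Qed.
Lemma scalqE a x :
  scalq a * x = Quat (a * q0 x) (a * q1 x) (a * q2 x) (a * q3 x).
Proof. by apply: quatP; rewrite ?quatE /=; ring. Qed.
Lemma scalqCA a x y : x * (scalq a * y) = scalq a * (x * y).
Proof. by rewrite mulrA -scalqC mulrA. Qed.
Lemma q0_scal a x : q0 (scalq a * x) = a * q0 x.
Proof. by rewrite scalqE. Qed.
Lemma scalq0 : scalq 0 = 0 :> quat R. Proof. by []. Qed.
Lemma mulq_trace x : x * x = scalq (q0 x *+ 2) * x - scalq (normq x).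
Proof. by apply: quatP; rewrite /normq ?quatE /= -?mulr_natr; ring. Qed.
Lemma conjq_pure x : q0 x = 0 -> conjq x = - x.
Proof. by move=> x0; apply: quatP; rewrite ?quatE //= x0 oppr0. Qed.
Lemma q0_conj_pure y x : q0 x = 0 -> q0 (y * x * conjq y) = 0.
Proof. by move=> x0; rewrite !quatE /= x0; ring. Qed.

End QuatTheory.

(** * Isotropic quaternions over a finite field *)

Section QuatField.
Variable F : fieldType.
Hypothesis F2 : 2%:R != 0 :> F.
Implicit Types g x y a d : quat F.

Lemma scalq_mulI (c : F) x : c != 0 -> scalq c * x = 0 -> x = 0.
Proof.
move=> c0 /(congr1 ( *%R (scalq c^-1))).
by rewrite mulrA -scalqM mulVf // mul1r mulr0.
Qed.

Lemma mulq_eq0_norm x y : x * y = 0 -> y != 0 -> normq x = 0.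
Proof.
move=> xy0 y0; apply/eqP/negPn/negP => nx; case/negP: y0; apply/eqP.
by apply: (scalq_mulI nx); rewrite -conj_mulq -mulrA xy0 mulr0.
Qed.

(** The vector part of [x * y] is the cross product. By Lagrange's identity the square of each of
    its coordinates is expressed by the two norms and the inner product, and vanishes with them. *)
Lemma isotropic_orth_mul x y : q0 x = 0 -> q0 y = 0 ->
  normq x = 0 -> normq y = 0 -> q0 (x * y) = 0 -> x * y = 0.
Proof.
move=> x0 y0 nx ny xy.
have cross (s s' t t' : F) u v : normq x = u ^+ 2 + s ^+ 2 + t ^+ 2 ->
    normq y = v ^+ 2 + s' ^+ 2 + t' ^+ 2 ->
    q0 (x * y) = - (u * v) - s * s' - t * t' -> s * t' - t * s' = 0.
  move=> enx eny exy; apply/eqP; rewrite -sqrf_eq0; apply/eqP.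
  have -> : (s * t' - t * s') ^+ 2 =
    (normq x - u ^+ 2) * (normq y - v ^+ 2) - (q0 (x * y) + u * v) ^+ 2.
    by rewrite enx eny exy; ring.
  by rewrite nx ny xy; ring.
apply: quatP => //; rewrite !quatE /= x0 y0.
- rewrite -[RHS](cross (q2 x) (q2 y) (q3 x) (q3 y) (q1 x) (q1 y));
    rewrite ?quatE /normq ?x0 ?y0; ring.
- rewrite -[RHS](cross (q3 x) (q3 y) (q1 x) (q1 y) (q2 x) (q2 y));
    rewrite ?quatE /normq ?x0 ?y0; ring.
- rewrite -[RHS](cross (q1 x) (q1 y) (q2 x) (q2 y) (q3 x) (q3 y));
    rewrite ?quatE /normq ?x0 ?y0; ring.
Qed.

Lemma trace_neq0 g : g != 0 -> exists u, q0 (g * u) != 0.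
Proof.
move=> gN0.
have [g0|g0] := eqVneq (q0 g) 0; last by exists 1; rewrite mulr1.
have [g1|g1] := eqVneq (q1 g) 0; last first.
  exists (Quat 0 1 0 0); rewrite !quatE /= g0.
  by rewrite !mul0r !mulr0 mulr1 !subr0 sub0r oppr_eq0.
have [g2|g2] := eqVneq (q2 g) 0; last first.
  exists (Quat 0 0 1 0); rewrite !quatE /= g0.
  by rewrite !mul0r !mulr0 mulr1 !subr0 sub0r oppr_eq0.
have [g3|g3] := eqVneq (q3 g) 0; last first.
  exists (Quat 0 0 0 1); rewrite !quatE /= g0.
  by rewrite !mul0r !mulr0 mulr1 !subr0 sub0r oppr_eq0.
by case/eqP: gN0; apply: quatP.
Qed.

(** For pure [g], [conjq (g * u)] is [- conjq u * g]. Inserting this scalar into a product brings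
    [g] next to the factors that it kills, which stands in for division by the zero divisor [g]. *)
Lemma pure_trace g u : q0 g = 0 ->
  scalq (q0 (g * u) *+ 2) = g * u - conjq u * g.
Proof. by move=> g0; apply: quatP; rewrite ?quatE /= g0; ring. Qed.

Lemma isotropic_line g v : q0 g = 0 -> g != 0 -> normq g = 0 ->
  q0 v = 0 -> normq v = 0 -> q0 (g * v) = 0 -> exists c, v = scalq c * g.
Proof.
move=> g0 gN0 ng v0 nv gv; have [u gu] := trace_neq0 gN0.
have gu2 : q0 (g * u) *+ 2 != 0 by rewrite -mulr_natr mulf_neq0.
exists ((q0 (g * u) *+ 2)^-1 * (q0 (v * conjq u) *- 2)).
suff e : scalq (q0 (g * u) *+ 2) * v = scalq (q0 (v * conjq u) *- 2) * g.
  by rewrite scalqM -mulrA -e mulrA -scalqM mulVf // mul1r.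
have vg : v * g = 0.
  apply: isotropic_orth_mul => //; rewrite -gv !quatE; ring.
rewrite pure_trace // mulrBl -mulrA -[conjq u * g * v]mulrA.
rewrite (isotropic_orth_mul g0 v0) // mulr0 subr0.
have -> : u * v = v * conjq u - scalq (q0 (v * conjq u) *+ 2).
  by apply: quatP; rewrite !quatE /= v0; ring.
rewrite mulrBr mulrA (isotropic_orth_mul g0 v0) // mul0r sub0r.
by move: (q0 (v * conjq u)) => c; apply: quatP; rewrite !quatE /=; ring.
Qed.

(** Modulo [p] this says that an [x] in the ideal of [a] has [conjq a * x] divisible by [p]; when
    [a] has norm [p], [x] is thus a right multiple of [a]. *)
Lemma pure_kernel g x y : q0 g = 0 -> g != 0 -> g * x = 0 -> g * y = 0 ->
  conjq x * y = 0.
Proof.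
move=> g0 gN0 gx gy.
have xg : conjq x * g = 0.
  by rewrite -[g]conjqK (conjq_pure g0) conjqN mulrN -conjqM gx conjq0 oppr0.
have [u gu] := trace_neq0 gN0.
apply: (@scalq_mulI (q0 (g * u) *+ 2)); first by rewrite -mulr_natr mulf_neq0.
rewrite mulrA scalqC pure_trace // mulrBr mulrBl !mulrA xg !mul0r sub0r.
by rewrite -!mulrA gy !mulr0 oppr0.
Qed.

(** In terms of 2x2 matrices, a nonzero [a] has rank 1 and [conjq a] kills exactly its image. So the
    left equation makes this image an eigenline of [g], with eigenvalue 0 because [g] is
    nilpotent. *)
Lemma pure_sandwich g a : q0 g = 0 -> g != 0 -> normq g = 0 -> normq a = 0 ->
  (conjq a * g * a == 0) = (g * a == 0).
Proof.
move=> g0 gN0 ng na; apply/eqP/eqP=> [aga|ga]; last by rewrite -mulrA ga mulr0.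
have gg : g * g = 0 by rewrite mulq_trace g0 ng mul0rn mul0r subr0.
have aa : a * a = scalq (q0 a *+ 2) * a.
  by rewrite mulq_trace na subr0.
pose s := q0 (conjq a * g) *+ 2.
have tr : conjq a * g = g * a + scalq s.
  by apply: quatP; rewrite /s ?quatE /= g0; ring.
have [s0|sN0] := eqVneq s 0; last first.
  apply: (scalq_mulI sN0); rewrite mulrA scalqC.
  move: aga; rewrite tr mulrDl => /(congr1 ( *%R g)).
  by rewrite mulr0 mulrDr !mulrA gg !mul0r add0r.
have [a0|aN0] := eqVneq (q0 a) 0.
  apply: isotropic_orth_mul => //; apply/eqP.
  have : s = - q0 (g * a) *+ 2.
    by rewrite /s !quatE /= g0 a0; ring.
  rewrite s0 => /esym/eqP; rewrite -mulr_natr mulf_eq0 (negPf F2) orbF.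
  by rewrite oppr_eq0.
apply: (@scalq_mulI (q0 a *+ 2)); first by rewrite -mulr_natr mulf_neq0.
by rewrite mulrA scalqC -mulrA -aa mulrA; rewrite tr s0 scalq0 addr0 in aga.
Qed.

(** Otherwise [d * a] is a nonzero pure quaternion with both [conjq a] and [d] in its right kernel,
    and [pure_kernel] gives [a * d = 0]. *)
Lemma swap_eq0 a d : q0 (a * d) = 0 -> a * d != 0 -> a * (d * a) = 0 ->
  (d * a) * d = 0 -> d * a = 0.
Proof.
move=> ad0 adN0 ada dad; apply/eqP/negPn/negP => daN0; case/eqP: adN0.
have da0 : q0 (d * a) = 0 by rewrite -ad0 !quatE; ring.
rewrite -[a]conjqK; apply: (pure_kernel da0 daN0) => //.
have -> : d * a = - conjq (d * a) by rewrite (conjq_pure da0) opprK.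
by rewrite mulNr -conjqM ada conjq0 oppr0.
Qed.

Lemma pure_annihilator a : a != 0 -> normq a = 0 ->
  exists2 v, v != 0 & q0 v = 0 /\ v * a = 0.
Proof.
move=> aN0 na.
have [a0|a0] := eqVneq (q0 a) 0.
  exists a; [exact: aN0 | split=> //].
  by rewrite mulq_trace na a0 mul0rn mul0r subr0.
have anni w : q0 w = 0 -> a * w * conjq a != 0 ->
    exists2 v, v != 0 & q0 v = 0 /\ v * a = 0.
  move=> w0 awN0; exists (a * w * conjq a); first exact: awN0.
  split; first exact: q0_conj_pure.
  by rewrite -mulrA conj_mulq na mulr0.
(* This is the trace of the map [w] to [a * w * conjq a] on pure quaternions. It is [4 (q0 a)^2],
   hence nonzero, so one of the three basis vectors has a nonzero image. *)
have : q1 (a * Quat 0 1 0 0 * conjq a) + q2 (a * Quat 0 0 1 0 * conjq a) +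
    q3 (a * Quat 0 0 0 1 * conjq a) != 0.
  have -> : q1 (a * Quat 0 1 0 0 * conjq a) + q2 (a * Quat 0 0 1 0 * conjq a) +
    q3 (a * Quat 0 0 0 1 * conjq a) = (2%:R * q0 a) ^+ 2 - normq a.
    by rewrite /normq !quatE /=; ring.
  by rewrite na subr0 expf_neq0 ?mulf_neq0.
have [e1|] := eqVneq (a * Quat 0 1 0 0 * conjq a) 0; last first.
  by move=> h _; apply: anni h.
have [e2|] := eqVneq (a * Quat 0 0 1 0 * conjq a) 0; last first.
  by move=> h _; apply: anni h.
have [e3|] := eqVneq (a * Quat 0 0 0 1 * conjq a) 0; last first.
  by move=> h _; apply: anni h.
by rewrite e1 e2 e3 /= !addr0 eqxx.
Qed.

End QuatField.

Section QuatFinField.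
Variable F : finFieldType.
Hypothesis F2 : 2%:R != 0 :> F.

Lemma card_setbij (T T' : finType) (A : {set T}) (B : {set T'})
    (f : T -> T') (g : T' -> T) :
  {in A, forall x, f x \in B /\ g (f x) = x} ->
  {in B, forall y, g y \in A /\ f (g y) = y} -> #|A| = #|B|.
Proof.
move=> fB gA; rewrite -(card_in_imset (f := f) (D := A)).
  apply: eq_card => y; apply/imsetP/idP => [[x xA ->]|yB].
    by case: (fB x xA).
  by exists (g y); case: (gA y yB).
by move=> x y /fB[_ {2}<-] /fB[_ {2}<-] ->.
Qed.

Lemma card_line (g : quat F) : g != 0 ->
  #|[set scalq c * g | c in F]| = #|F|.
Proof.
move=> gN0; rewrite card_imset // => c d e.
apply/eqP; rewrite -subr_eq0; apply/negPn/negP => cd; case/negP: gN0.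
apply/eqP/(scalq_mulI cd); have -> : scalq (c - d) = scalq c - scalq d.
  by apply: quatP; rewrite !quatE /= ?subr0.
by rewrite mulrBl e subrr.
Qed.

Lemma card_annihilator (a : quat F) : a != 0 -> normq a = 0 ->
  #|[set v : quat F | (q0 v == 0) && (v * a == 0)]| = #|F|.
Proof.
move=> aN0 na; have [w wN0 [w0 wa]] := pure_annihilator F2 aN0 na.
rewrite -(card_line wN0); apply: eq_card => v; rewrite inE.
apply/andP/imsetP => [[/eqP v0 /eqP va]|[c _ ->]]; last first.
  by rewrite -mulrA wa mulr0 eqxx scalqE /= w0 mulr0 eqxx.
have nv := mulq_eq0_norm va aN0; have nw := mulq_eq0_norm wa aN0.
have [|c ->] := isotropic_line F2 w0 wN0 nw v0 nv; last by exists c.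
(* Two pure annihilators of [a] are orthogonal: the scalar [w * v + v * w] kills [a]. *)
apply/eqP/negPn/negP => wv.
have: scalq (q0 (w * v) *+ 2) * a = 0.
  by rewrite (pure_trace _ w0) (conjq_pure v0) mulrBl !mulNr opprK -!mulrA wa va
    !mulr0 addr0.
move/scalq_mulI => e; case/eqP: aN0; apply: e.
by rewrite -mulr_natr mulf_neq0.
Qed.

Lemma card_pure : #|[set v : quat F | q0 v == 0]| = (#|F| ^ 3)%N.
Proof.
have -> : (#|F| ^ 3)%N = #|[set: F * F * F]|.
  by rewrite cardsT !card_prod expnSr expnSr expn1.
apply: (card_setbij (f := fun v => (q1 v, q2 v, q3 v))
  (g := fun t => Quat 0 t.1.1 t.1.2 t.2)).
  by move=> v; rewrite !inE => /eqP v0; split => //; apply: quatP.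
by move=> [[a b] c] _; rewrite inE /= eqxx.
Qed.

Lemma card_orthogonal (g : quat F) : q0 g = 0 -> g != 0 ->
  #|[set v : quat F | (q0 v == 0) && (q0 (g * v) == 0)]| = (#|F| ^ 2)%N.
Proof.
move=> g0 gN0; have [u gu] := trace_neq0 gN0.
have [w w0 gw] : exists2 w, q0 w = 0 & q0 (g * w) = 1.
  exists (scalq (q0 (g * u))^-1 * (u - scalq (q0 u))).
    by rewrite !quatE /=; ring.
  have -> : forall c, q0 (g * (scalq c * (u - scalq (q0 u)))) = c * q0 (g * u).
    by move=> c; rewrite !quatE /= g0; ring.
  by rewrite mulVf.
apply/eqP; rewrite -(eqn_pmul2l (m := #|F|)); last by apply/card_gt0P; exists 0.
rewrite -expnS -card_pure -[X in (X * _)%N]cardsT -cardsX; apply/eqP.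
apply: (@card_setbij (F * quat F)%type (quat F) _ _
  (fun t => t.2 + scalq t.1 * w)
  (fun v => (q0 (g * v), v - scalq (q0 (g * v)) * w))).
  move=> [c v]; case/setXP => _; rewrite !inE -[(c, v).2]/v -[(c, v).1]/c.
  case/andP => /eqP v0 /eqP gv.
  have gc : q0 (g * (v + scalq c * w)) = c.
    by rewrite mulrDr scalqCA q0_add q0_scal gv gw; ring.
  by rewrite gc addrK; split=> //; rewrite !quatE /= v0 w0; apply/eqP; ring.
move=> v vP; split; last exact: subrK.
apply/setXP; move: vP; rewrite !inE => /eqP v0.
split => //; apply/andP; split.
  by rewrite !quatE /= v0 w0; apply/eqP; ring.
by rewrite mulrBr scalqCA q0_add q0_opp q0_scal gw mulr1 subrr.
Qed.

(* Stereographic projection from [g]: the cone minus the tangent plane at [g],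
   times the line spanned by [g], is the complement of that plane. *)
Lemma card_isotropic (g : quat F) : q0 g = 0 -> g != 0 -> normq g = 0 ->
  #|[set v : quat F | (q0 v == 0) && (normq v == 0)]| = (#|F| ^ 2)%N.
Proof.
move=> g0 gN0 ng.
pose T := [set v : quat F | q0 (g * v) == 0].
have gg : g * g = 0 by rewrite mulq_trace ng g0 mul0rn mul0r subr0.
rewrite -(cardsID T).
have -> : #|[set v : quat F | (q0 v == 0) && (normq v == 0)] :&: T| = #|F|.
  rewrite -(card_line gN0); apply: eq_card => v; rewrite !inE.
  apply/andP/imsetP => [[/andP[/eqP v0 /eqP nv] /eqP gv]|[c _ ->]].
    by have [c ->] := isotropic_line F2 g0 gN0 ng v0 nv gv; exists c.
  by rewrite normqM ng mulr0 eqxx scalqCA gg !q0_scal g0 !mulr0 eqxx.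
apply/eqP; rewrite -(eqn_pmul2l (m := #|F|)); last by apply/card_gt0P; exists 0.
rewrite mulnDr mulnn -expnS; apply/eqP.
have := cardsID T [set v : quat F | q0 v == 0].
rewrite card_pure [_ :&: T]setIC.
have -> : #|T :&: [set v : quat F | q0 v == 0]| = (#|F| ^ 2)%N.
  rewrite -(card_orthogonal g0 gN0); apply: eq_card => v.
  by rewrite !inE andbC.
have -> : #|[set v : quat F | q0 v == 0] :\: T| =
    muln #|F| #|[set v : quat F | (q0 v == 0) && (normq v == 0)] :\: T|;
  last first.
  by move=> <-.
rewrite -[X in (X * _)%N]cardsT -cardsX; apply/esym.
have shift c v : q0 (g * (v + scalq c * g)) = q0 (g * v).
  by rewrite mulrDr scalqCA gg mulr0 addr0.
have norm_shift c v : q0 v = 0 ->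
    normq (v + scalq c * g) = normq v - q0 (g * v) * 2%:R * c.
  move=> v0; transitivity (normq v - q0 (g * v) * 2%:R * c + c ^+ 2 * normq g).
    by rewrite /normq !quatE /= g0 v0; ring.
  by rewrite ng mulr0 addr0.
(* Along the direction [g] the norm is affine with slope [- (q0 (g * v) * 2)], nonzero off the
   tangent plane; subtracting [t v] times [g] is the one way to reach the cone. *)
pose t v := normq v / (- (q0 (g * v) * 2%:R)).
apply: (@card_setbij (F * quat F)%type (quat F) _ _
  (fun u => u.2 + scalq u.1 * g) (fun v => (t v, v - scalq (t v) * g))).
  move=> [c v]; case/setXP => _; rewrite !inE -[(c, v).2]/v -[(c, v).1]/c.
  case/andP => gv /andP[/eqP v0 /eqP nv].
  rewrite shift gv; split; first by rewrite !quatE /= v0 g0; apply/eqP; ring.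
  have -> : t (v + scalq c * g) = c; last by rewrite addrK.
  have B0 : q0 (g * v) * 2%:R != 0 by rewrite mulf_neq0.
  rewrite /t shift norm_shift // nv sub0r invrN mulrNN mulrAC mulfV //.
  by rewrite mul1r.
move=> v vP; split; last exact: subrK.
have e : v - scalq (t v) * g = v + scalq (- t v) * g.
  by apply: quatP; rewrite !quatE /=; ring.
apply/setXP; move: vP; rewrite e !inE shift => /andP[gv /eqP v0]; rewrite gv.
split => //; rewrite norm_shift // q0_add q0_scal v0 g0 mulr0 addr0 eqxx.
rewrite /t invrN mulrN opprK mulrCA mulrN mulfV ?mulf_neq0 //.
by rewrite mulrN1 subrr eqxx.
Qed.

End QuatFinField.

(** * Integral quaternions and their reduction modulo an odd prime *)

Section Reduction.
Variable R : comNzRingType.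
Implicit Types x y : quat int.

Definition redq x : quat R :=
  Quat (q0 x)%:~R (q1 x)%:~R (q2 x)%:~R (q3 x)%:~R.

Lemma redqM x y : redq (x * y) = redq x * redq y.
Proof. by apply: quatP; rewrite !quatE /=; ring. Qed.
Lemma redq_conj x : redq (conjq x) = conjq (redq x).
Proof. by apply: quatP => /=; ring. Qed.
Lemma redq_scal a : redq (scalq a) = scalq a%:~R.
Proof. by apply: quatP. Qed.
Lemma normq_red x : normq (redq x) = (normq x)%:~R.
Proof. by rewrite /normq /=; ring. Qed.

End Reduction.

Definition dvdq (m : nat) (x : quat int) : bool :=
  [&& (m %| q0 x)%Z, (m %| q1 x)%Z, (m %| q2 x)%Z & (m %| q3 x)%Z].

Lemma dvdqP m x : reflect (exists y, x = scalq m%:Z * y) (dvdq m x).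
Proof.
apply: (iffP and4P) => [[/dvdzP[a ea] /dvdzP[b eb] /dvdzP[c ec] /dvdzP[d ed]]|].
  exists (Quat a b c d); rewrite scalqE.
  by apply: quatP => /=; rewrite mulrC.
by case=> y ->; rewrite scalqE /= !dvdz_mulr.
Qed.

Lemma scalq_inj (m : nat) : (0 < m)%N -> injective ( *%R (scalq m%:Z)).
Proof.
move=> m0 x y; have mN0 : m%:Z != 0 by rewrite -lt0n in m0 *; lia.
by rewrite !scalqE => -[] /(mulfI mN0) ? /(mulfI mN0) ? /(mulfI mN0) ?
  /(mulfI mN0) ?; apply: quatP.
Qed.

Lemma normq_ge0 (x : quat int) : 0 <= normq x.
Proof. by rewrite /normq !addr_ge0 ?sqr_ge0. Qed.

Lemma normq_eq0 (x : quat int) : (normq x == 0) = (x == 0).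
Proof.
apply/eqP/eqP=> [|->]; last exact: normq0.
move/eqP; rewrite /normq !paddr_eq0 ?addr_ge0 ?sqr_ge0 // !sqrf_eq0.
by case/andP=> /andP[/andP[/eqP ? /eqP ?] /eqP ?] /eqP ?; apply: quatP.
Qed.

Definition int_range (n : nat) : seq int :=
  [seq i%:Z - n%:Z | i <- iota 0 n.*2.+1].

Lemma mem_int_range n (z : int) : (z \in int_range n) = (`|z| <= n%:Z).
Proof.
apply/mapP/idP => [[i]|zn]; first by rewrite mem_iota => /andP[_ ?] ->; lia.
by exists (absz (z + n%:Z)); rewrite ?mem_iota; lia.
Qed.

Lemma int_range_uniq n : uniq (int_range n).
Proof.
by rewrite map_inj_uniq ?iota_uniq // => i j /= /addIr [].
Qed.

(** The box is complete: an integer is at most its square in absolute value, so the coordinates of a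
    quaternion of norm [n] lie between [-n] and [n]. *)
Definition norm_list (n : nat) : seq (quat int) :=
  let r := int_range n in let r2 := [seq (a, b) | a <- r, b <- r] in
  [seq x <- [seq Quat u.1 u.2 v.1 v.2 | u <- r2, v <- r2] | normq x == n%:Z].

Lemma norm_list_uniq n : uniq (norm_list n).
Proof.
rewrite filter_uniq // allpairs_uniq //.
- by rewrite allpairs_uniq ?int_range_uniq // => -[a b] [c d].
- by rewrite allpairs_uniq ?int_range_uniq // => -[a b] [c d].
by move=> [[a b] [c d]] [[a' b'] [c' d']] _ _ [-> -> -> ->].
Qed.

Lemma le_sqr (z : int) : `|z| <= z ^+ 2.
Proof. have [z0|z0] := lerP 0 z; nia. Qed.

Lemma mem_norm_list n x : (x \in norm_list n) = (normq x == n%:Z).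
Proof.
rewrite mem_filter andb_idr // => /eqP; rewrite /normq => nx.
rewrite [x in x \in _](_ : _ = Quat (q0 x, q1 x).1 (q0 x, q1 x).2
  (q2 x, q3 x).1 (q2 x, q3 x).2); last by case: x {nx}.
apply: (allpairs_f (fun u v => Quat u.1 u.2 v.1 v.2));
  apply: (allpairs_f pair);
  rewrite mem_int_range -nx (le_trans (le_sqr _)) //; nra.
Qed.

Lemma size_bij (T T' : eqType) (s : seq T) (s' : seq T') f g :
  uniq s -> uniq s' ->
  {in s, forall x, f x \in s' /\ g (f x) = x} ->
  {in s', forall y, g y \in s /\ f (g y) = y} -> size s = size s'.
Proof.
move=> us us' fs gs; rewrite -(size_map f s); apply: perm_size.
apply: uniq_perm => //.
  by rewrite map_inj_in_uniq // => x y /fs[_ {2}<-] /fs[_ {2}<-] ->.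
move=> y; apply/mapP/idP => [[x /fs[+ _] ->]//|/gs[gy e]].
by exists (g y).
Qed.

Lemma size_units : size (norm_list 1) = 8%N.
Proof. by vm_compute. Qed.

Lemma normq_lt (k : nat) (a b c d : int) : 2 * `|a| < k%:Z ->
  2 * `|b| < k%:Z -> 2 * `|c| < k%:Z -> 2 * `|d| < k%:Z ->
  normq (Quat a b c d) < (k ^ 2)%:Z.
Proof.
have sqr_lt (z : int) : 2 * `|z| < k%:Z -> 4%:Z * z ^+ 2 < (k ^ 2)%:Z.
  by have [z0|z0] := lerP 0 z; nia.
move=> /sqr_lt la /sqr_lt lb /sqr_lt lc /sqr_lt ld.
by rewrite /normq /=; lia.
Qed.

(** Oddness of [k] makes the bound strict: no residue is exactly [k / 2]. The strict bound makes the
    norm of four such residues smaller than [k^2]. *)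
Lemma small_residue (k : nat) (a : int) : odd k ->
  exists2 w, (k %| a - w)%Z & 2 * `|w| < k%:Z.
Proof.
move=> ok; have k0 : (k%:Z != 0) by case: k ok.
have := divz_eq a k%:Z; have := modz_ge0 a k0; have := ltz_mod a k0.
move: (a %/ k)%Z (a %% k)%Z => q r rk r0 ->.
have [rk2|rk2] := ltrP (2 * r) k%:Z.
  by exists r; [rewrite addrK dvdz_mull | lia].
exists (r - k%:Z); last by have : 2 * r != k%:Z; [lia | lia].
have -> : q * k%:Z + r - (r - k%:Z) = (q + 1) * k%:Z by ring.
by rewrite dvdz_mull.
Qed.

Section OddPrime.
Variable p : nat.
Hypothesis p_pr : prime p.
Hypothesis p_odd : odd p.
Let F := 'F_p.

Lemma dvdp_int (z : int) : (p %| z)%Z = (z%:~R == 0 :> F).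
Proof. exact: (dvdz_pcharf (pchar_Fp p_pr)). Qed.

Lemma Fp2 : 2%:R != 0 :> F.
Proof.
rewrite -(dvdn_pcharf (pchar_Fp p_pr)); apply/negP => /(@dvdn_leq _ 2 erefl).
by case: p p_odd p_pr => [|[|[|]]].
Qed.

Lemma redq_eq0 x : (redq F x == 0) = dvdq p x.
Proof.
rewrite /dvdq !dvdp_int; apply/eqP/and4P => [e|[/eqP ? /eqP ? /eqP ? /eqP ?]].
  by split; apply/eqP; [move/(congr1 (@q0 _)): e | move/(congr1 (@q1 _)): e
    | move/(congr1 (@q2 _)): e | move/(congr1 (@q3 _)): e].
exact: quatP.
Qed.

Lemma int_lift (c : F) : exists2 z : int, z%:~R = c & 2 * `|z| < p%:Z.
Proof.
have [w] := small_residue (c : nat)%:Z p_odd; rewrite dvdp_int => e wp.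
exists w => //; apply/esym/eqP; rewrite -subr_eq0; move: e.
by rewrite rmorphB /= -pmulrn natr_Zp.
Qed.

Lemma redq_lift (v : quat F) : exists2 x, redq F x = v & normq x < (p ^ 2)%:Z.
Proof.
have [a ea la] := int_lift (q0 v); have [b eb lb] := int_lift (q1 v).
have [c ec lc] := int_lift (q2 v); have [d ed ld] := int_lift (q3 v).
exists (Quat a b c d); first exact: quatP.
exact: normq_lt.
Qed.

(** Pigeonhole: the squares and the elements [-1 - s] for [s] a square are [(p + 1) / 2] each, too
    many to be disjoint. *)
Lemma sum_two_squares_m1 : exists a b : F, a ^+ 2 + b ^+ 2 = -1.
Proof.
pose h := p.+1./2; pose sq (i : 'I_h) : F := (i : nat)%:R ^+ 2.
have ph : (h + h = p.+1)%N by rewrite /h; lia.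
have sqI : injective sq.
  move=> i j /eqP; rewrite /sq eqf_sqr => /orP[/eqP /(congr1 val)|].
    have := ltn_ord i; have := ltn_ord j => hj hi.
    by rewrite /= !val_Fp_nat // !modn_small => [/val_inj||] //; lia.
  rewrite -subr_eq0 opprK -natrD -(dvdn_pcharf (pchar_Fp p_pr)).
  have := ltn_ord i; have := ltn_ord j => hj hi.
  case: (posnP (i + j)) => [e _|ij /(dvdn_leq ij)]; last by lia.
  by apply: val_inj => /=; lia.
have sqI' : injective (fun i => -1 - sq i) by move=> i j /addrI /oppr_inj /sqI.
pose A : {set F} := [set sq i | i in 'I_h].
pose B : {set F} := [set -1 - sq i | i in 'I_h].
have cAB : (#|A :|: B| <= p)%N by rewrite (leq_trans (max_card _)) ?card_Fp.
have : #|A :&: B| != 0%N.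
  have := cardsUI A B; rewrite !card_imset // card_ord ph.
  by apply: contra_eqN => /eqP ->; rewrite addn0; apply/eqP; lia.
rewrite cards_eq0 => /set0Pn[x]; rewrite inE.
case/andP => /imsetP[i _ ->] /imsetP[j _ e].
by exists (i : nat)%:R, (j : nat)%:R; rewrite -[_ ^+ 2]/(sq i) e subrK.
Qed.

End OddPrime.

Definition divq (m : nat) (x : quat int) : quat int :=
  Quat (q0 x %/ m)%Z (q1 x %/ m)%Z (q2 x %/ m)%Z (q3 x %/ m)%Z.

Lemma scalqK m : (0 < m)%N -> cancel ( *%R (scalq m%:Z)) (divq m).
Proof.
move=> m0 y; have mN0 : m%:Z != 0 by lia.
by rewrite scalqE; apply: quatP; rewrite /= mulKz.
Qed.

Lemma dvdq_scalM (m n : nat) y : (0 < m)%N ->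
  dvdq (m * n) (scalq m%:Z * y) = dvdq n y.
Proof.
move=> m0; apply/dvdqP/dvdqP => -[z].
  by rewrite PoszM scalqM -mulrA => /(scalq_inj m0) ->; exists z.
by move=> ->; exists z; rewrite PoszM scalqM mulrA.
Qed.

(** An even norm has an even number of odd coordinates, so the coordinates split into two pairs of
    equal parity; [u] is [1 + i], [1 + j] or [1 + k] according to the partner of the first one.
    Halving [v * u] then halves the norm of [v]. *)
Lemma even_norm_factor (v : quat int) : (2 %| normq v)%Z ->
  exists2 u, normq u = 2 & dvdq 2 (v * u).
Proof.
have par (z : int) : exists t, z ^+ 2 = z + 2 * t.
  have [t [->|->]] : exists t, z = 2 * t \/ z = 2 * t + 1.
    by exists (z %/ 2)%Z; lia.
  - by exists (2 * t ^+ 2 - t); ring.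
  - by exists (2 * t ^+ 2 + t); ring.
case: v => a b c d; rewrite /normq /=.
have [ta ->] := par a; have [tb ->] := par b; have [tc ->] := par c.
have [td ->] := par d => ev.
have [ab|ab] := boolP (2 %| a - b)%Z; last first.
  have [ac|ac] := boolP (2 %| a - c)%Z.
    by exists (Quat 1 0 1 0); rewrite // /dvdq !quatE /=; lia.
  by exists (Quat 1 0 0 1); rewrite // /dvdq !quatE /=; lia.
by exists (Quat 1 1 0 0); rewrite // /dvdq !quatE /=; lia.
Qed.

(** * Quaternions of norm [p] *)

Section OddPrime.
Variable p : nat.
Hypothesis p_pr : prime p.
Hypothesis p_odd : odd p.
Let F := 'F_p.
Implicit Types (g : quat F) (v a : quat int).

Lemma ideal_div g v u z (m : nat) : ~~ (p %| m)%N ->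
  g * redq F v = 0 -> v * u = scalq m%:Z * z -> g * redq F z = 0.
Proof.
move=> pm gv e; apply: (@scalq_mulI _ (m%:Z)%:~R).
  by rewrite -(dvdp_int p_pr) dvdzE.
by rewrite -scalqCA -redq_scal -redqM -e redqM mulrA gv mul0r.
Qed.

(* Lagrange's descent, carried out inside the right ideal annihilated by [g]. *)
Lemma ideal_descent g (k : nat) v : (0 < k < p)%N -> g * redq F v = 0 ->
  normq v = (k * p)%:Z ->
  exists2 a : quat int, normq a = p%:Z & g * redq F a = 0.
Proof.
have p0 := prime_gt0 p_pr.
elim/ltn_ind: k v => k IH v /andP[k0 kp] gv nv.
have pk : ~~ (p %| k)%N by apply/negP => /(dvdn_leq k0); lia.
have [k1|k1] := eqVneq k 1%N; first by exists v; rewrite // nv k1 mul1n.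
(* For even [k] a centred residue may equal [k / 2] and the descent need not be strict; a right
   factor of norm 2 halves [k] instead. *)
have [ek|ok] := boolP (2 %| k)%N.
  have [|u nu /dvdqP[z e]] := @even_norm_factor v; first by rewrite nv; lia.
  apply: (IH (k %/ 2)%N _ z); first by lia.
  - by lia.
  - by apply: (ideal_div _ gv e); apply/negP => /(@dvdn_leq _ 2 erefl);
      case: p p_odd p_pr => [|[|[|]]].
  have := congr1 (@normq _) e; rewrite !normqM normq_scal nv nu.
  by case/dvdnP: ek => q ->; rewrite mulnK //; lia.
have ok' : odd k by lia.
have [w0 kw0 lw0] := small_residue (q0 v) ok'.
have [w1 kw1 lw1] := small_residue (q1 v) ok'.
have [w2 kw2 lw2] := small_residue (q2 v) ok'.
have [w3 kw3 lw3] := small_residue (q3 v) ok'.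
pose w := Quat w0 w1 w2 w3.
have /dvdqP[y ey] : dvdq k (v - w) by rewrite /dvdq !quatE /=; apply/and4P.
(* With [w = v - k y], the product [v * conjq w] equals [k p - k v * conjq y]. Its quotient [z] by
   [k] stays in the ideal and has norm [p * normq w / k], which is less than [k p]. *)
pose z := scalq p%:Z - v * conjq y.
have e : v * conjq w = scalq k%:Z * z.
  have -> : w = v - scalq k%:Z * y by rewrite -ey opprB addrC subrK.
  have -> : conjq (v - scalq k%:Z * y) = conjq v - scalq k%:Z * conjq y.
    by apply: quatP; rewrite !quatE /=; ring.
  by rewrite /z !mulrBr mulq_conj nv PoszM scalqM scalqCA.
have nw : normq w < (k ^ 2)%:Z by exact: normq_lt.
clear kw0 lw0 kw1 lw1 kw2 lw2 kw3 lw3.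
have kN0 : k%:Z != 0 by lia.
have nz : p%:Z * normq w = k%:Z * normq z.
  have := congr1 (@normq _) e; rewrite !normqM normq_conj normq_scal nv PoszM.
  by rewrite expr2 -!mulrA => /(mulfI kN0).
have /dvdzP[k' ek'] : (k %| normq w)%Z.
  rewrite -(@Gauss_dvdzr _ p%:Z) ?nz ?dvdz_mulr //.
  by rewrite coprimezE coprime_sym prime_coprime.
have wge0 := normq_ge0 w.
have k'0 : k' != 0.
  apply/eqP => k'0; move: ek'; rewrite k'0 mul0r => /eqP.
  rewrite normq_eq0 => /eqP w0'; move: ey; rewrite w0' subr0 => ev.
  have /(mulfI kN0) : k%:Z * p%:Z = k%:Z * (k%:Z * normq y).
    by rewrite -PoszM -nv ev normqM normq_scal expr2 mulrA.
  move=> epk; have /prime_nt_dvdP : (k %| p)%N.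
    by apply/dvdnP; exists (absz (normq y)); lia.
  by move=> /(_ p_pr k1) ekp; rewrite ekp ltnn in kp.
have kpos : 0 < k%:Z by lia.
have k'ge0 : 0 <= k' by rewrite -(pmulr_lge0 _ kpos) -ek'.
have k'k : k' < k%:Z by rewrite -(ltr_pM2r kpos) -ek' -PoszM mulnn.
have nz' : normq z = (absz k' * p)%:Z.
  by apply: (mulfI kN0); rewrite -nz ek' PoszM gez0_abs //; ring.
have gz := ideal_div pk gv e.
by clear nv ey e nw nz ek' wge0; apply: (IH (absz k') _ z) => //; lia.
Qed.

Lemma exists_norm_p g : q0 g = 0 -> g != 0 -> normq g = 0 ->
  exists2 a : quat int, normq a = p%:Z & g * redq F a = 0.
Proof.
move=> g0 gN0 ng; have [x rx nx] := redq_lift p_pr p_odd g.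
have : (p %| normq x)%Z by rewrite (dvdp_int p_pr) -normq_red rx ng.
case/dvdzP => k ek; have := normq_ge0 x; have p0 := prime_gt0 p_pr => nx0.
have kN0 : k != 0.
  apply/eqP => k0; move: ek; rewrite k0 mul0r => /eqP; rewrite normq_eq0.
  move=> /eqP x0; case/eqP: gN0; rewrite -rx x0; exact: quatP.
have ppos : 0 < p%:Z by lia.
have k0 : 0 <= k by rewrite -(pmulr_lge0 _ ppos) -ek.
have kp : k < p%:Z by rewrite -(ltr_pM2r ppos) -ek -PoszM mulnn.
apply: (@ideal_descent g (absz k) x).
- by clear -kN0 k0 kp; lia.
(* A pure isotropic [g] satisfies [g * g = 0], so its own lift starts the descent. *)
- by rewrite rx mulq_trace g0 ng mul0rn mul0r subr0.
by rewrite ek PoszM gez0_abs.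
Qed.

Lemma count_annihilated g : q0 g = 0 -> g != 0 -> normq g = 0 ->
  count (fun a => g * redq F a == 0) (norm_list p) = 8%N.
Proof.
move=> g0 gN0 ng; have [a na ga] := exists_norm_p g0 gN0 ng.
have p0 := prime_gt0 p_pr.
rewrite -size_filter -size_units; apply/esym.
apply: (size_bij (f := fun u => a * u) (g := fun x => divq p (conjq a * x))).
- exact: norm_list_uniq.
- by rewrite filter_uniq ?norm_list_uniq.
- move=> u; rewrite mem_norm_list [_ \in filter _ _]mem_filter mem_norm_list.
  move=> /eqP nu; rewrite normqM na nu mulr1 eqxx redqM [g * _]mulrA ga mul0r.
  by rewrite eqxx mulrA conj_mulq na scalqK.
move=> x; rewrite [_ \in filter _ _]mem_filter !mem_norm_list.
case/andP => /eqP gx /eqP nx.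
have /dvdqP[u eu] : dvdq p (conjq a * x).
  rewrite -(redq_eq0 p_pr) redqM redq_conj; apply/eqP.
  exact: (pure_kernel (Fp2 p_pr p_odd) g0 gN0).
have ex : a * u = x.
  by apply: (scalq_inj p0); rewrite -scalqCA -eu mulrA mulq_conj na.
rewrite eu scalqK //; split=> //.
have := congr1 (@normq _) ex; rewrite normqM na nx => /eqP.
by rewrite -{2}[p%:Z]mulr1 (inj_eq (mulfI _)) //; lia.
Qed.

Lemma redq_norm_p a : normq a = p%:Z -> redq F a != 0 /\ normq (redq F a) = 0.
Proof.
move=> na; split; last first.
  by apply/eqP; rewrite normq_red na -(dvdp_int p_pr) dvdzz.
rewrite (redq_eq0 p_pr); apply/negP => /dvdqP[y] /(congr1 (@normq _)).
rewrite normqM normq_scal na => e.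
have /prime_gt1 := p_pr; have : p%:Z != 0 by have := prime_gt0 p_pr; lia.
move/mulfI => mI; move: e; rewrite -{1}[p%:Z]mulr1 expr2 -mulrA => /mI.
by have := normq_ge0 y; nia.
Qed.

(** Double counting of the pairs [(a, v)] with [v] nonzero, pure, isotropic and [v * a = 0] modulo
    [p]: each [a] has [p - 1] such [v], and each of the [p^2 - 1] vectors [v] has 8 such [a]. *)
Lemma size_norm_p : size (norm_list p) = (8 * p.+1)%N.
Proof.
have p1 := prime_gt1 p_pr; have F2 := Fp2 p_pr p_odd.
have cF : #|F| = p by rewrite card_Fp.
have [b [c bc]] := sum_two_squares_m1 p_pr p_odd.
pose v0 : quat F := Quat 0 1 b c.
have nv0 : normq v0 = 0 by rewrite /normq /= -addrA bc; ring.
have v0N0 : v0 != 0 by apply/eqP => -[] /eqP; rewrite oner_eq0.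
pose I : {set quat F} := [set v : quat F | (q0 v == 0) && (normq v == 0)].
have cI : #|I :\ (0 : quat F)| = (p ^ 2 - 1)%N.
  have := cardsD1 (0 : quat F) I.
  rewrite (card_isotropic F2 (erefl : q0 v0 = 0)) // cF.
  by rewrite inE normq0 !eqxx => ->; rewrite addKn.
have : (\sum_(a <- norm_list p)
      \sum_(v in I :\ (0%R : quat F)) (v * redq F a == 0)%R =
    \sum_(a <- norm_list p) (p - 1))%N.
  rewrite big_seq [RHS]big_seq; apply: eq_bigr => a.
  rewrite mem_norm_list => /eqP /redq_norm_p[aN0 na].
  have := cardsD1 (0 : quat F)
    [set v : quat F | (q0 v == 0) && (v * redq F a == 0)].
  rewrite (card_annihilator F2 aN0 na) cF inE mul0r !eqxx => e.
  rewrite [X in _ = (X - 1)%N]e add1n subn1 /= -sum1_card big_mkcond.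
  rewrite [RHS]big_mkcond /=.
  apply: eq_bigr => v _; rewrite !inE.
  case: (altP (v * _ =P 0)) => [va|_]; rewrite ?andbF //=.
    by rewrite (mulq_eq0_norm va aN0) eqxx !andbT; case: ifP.
  by case: ifP.
rewrite exchange_big /= big_const_seq count_predT iter_addn_0.
rewrite (eq_bigr (fun=> 8%N)) => [|v]; last first.
  rewrite !inE => /and3P[vN0 /eqP v0' /eqP nv].
  rewrite -(count_annihilated v0' vN0 nv) -sum1_count [RHS]big_mkcond /=.
  by apply: eq_bigr => a _; case: eqP.
rewrite sum_nat_const cI => e; apply/eqP.
rewrite -(eqn_pmul2l (m := (p - 1)%N)) ?subn_gt0 // -e; apply/eqP.
by nia.
Qed.

End OddPrime.

(** * The Hecke relation for sums of three squares *)

Definition r3 (n : nat) : nat := count (fun x => q0 x == 0) (norm_list n).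

Lemma mem_filter_norm (P : pred (quat int)) n x :
  (x \in filter P (norm_list n)) = P x && (normq x == n%:Z).
Proof. by rewrite mem_filter mem_norm_list. Qed.

Lemma count_norm_bij (m n : nat) (P Q : pred (quat int))
    (f g : quat int -> quat int) :
  (forall x, normq x = m%:Z -> P x ->
    [/\ normq (f x) = n%:Z, Q (f x) & g (f x) = x]) ->
  (forall y, normq y = n%:Z -> Q y ->
    [/\ normq (g y) = m%:Z, P (g y) & f (g y) = y]) ->
  count P (norm_list m) = count Q (norm_list n).
Proof.
move=> fP gP; rewrite -!size_filter.
apply: (size_bij (f := f) (g := g)); try exact: filter_uniq (norm_list_uniq _).
  by move=> x; rewrite !mem_filter_norm => /andP[Px /eqP nx];
    have [-> -> ->] := fP x nx Px; rewrite eqxx.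
by move=> y; rewrite !mem_filter_norm => /andP[Qy /eqP ny];
  have [-> -> ->] := gP y ny Qy; rewrite eqxx.
Qed.

Lemma count_multiples (m n : nat) : (0 < m)%N ->
  count (fun x => (q0 x == 0) && dvdq m x) (norm_list (m ^ 2 * n)) = r3 n.
Proof.
move=> m0; have mN0 : m%:Z != 0 by lia.
have m2 : (m ^ 2)%N%:Z = m%:Z ^+ 2 by rewrite -mulnn PoszM.
apply: (@count_norm_bij _ _ _ _ (divq m) ( *%R (scalq m%:Z))) => x nx.
  case/andP=> x0 /dvdqP[y ey]; move: x0 nx; rewrite ey scalqK //.
  rewrite q0_scal normqM normq_scal PoszM m2 mulf_eq0 (negPf mN0) => y0.
  by move/(mulfI (expf_neq0 2 mN0)).
move=> x0; rewrite scalqK // q0_scal (eqP x0) mulr0 eqxx.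
rewrite normqM normq_scal nx PoszM m2; split=> //.
by apply/dvdqP; exists x.
Qed.

Section OddPrime.
Variable p : nat.
Hypothesis p_pr : prime p.
Hypothesis p_odd : odd p.
Let F := 'F_p.
Implicit Types (g a : quat int).

(** The divisibility characterizes the image of the map [b] to [a * b * conjq a], since sandwiching
    such a product by [conjq a] and [a] multiplies [b] by [p^2]. *)
Lemma count_sandwich n a : normq a = p%:Z ->
  count (fun g => (q0 g == 0) && dvdq (p ^ 2) (conjq a * g * a))
    (norm_list (p ^ 2 * n)) = r3 n.
Proof.
move=> na; have p0 : (0 < p ^ 2)%N by rewrite expn_gt0 prime_gt0.
have p2 : (p ^ 2)%N%:Z = p%:Z ^+ 2 by rewrite -mulnn PoszM.
have pN0 : p%:Z ^+ 2 != 0 by rewrite expf_neq0 //; lia.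
apply: (@count_norm_bij _ _ _ _ (fun g => divq (p ^ 2) (conjq a * g * a))
  (fun b => a * b * conjq a)) => x nx; last first.
  move=> /eqP x0.
  have -> : conjq a * (a * x * conjq a) * a = scalq (p ^ 2)%:Z * x.
    rewrite !mulrA conj_mulq na -[_ * conjq a * a]mulrA conj_mulq na.
    by rewrite -scalqC mulrA -scalqM p2.
  rewrite scalqK // q0_conj_pure // !normqM normq_conj na nx eqxx PoszM p2.
  by split=> //; [ring | apply/dvdqP; exists x].
case/andP=> /eqP x0 /dvdqP[y ey]; rewrite ey scalqK //.
have exy : a * y * conjq a = x.
  apply: (scalq_inj p0); rewrite mulrA -scalqCA -ey !mulrA mulq_conj na.
  by rewrite -mulrA mulq_conj na -scalqC mulrA -scalqM p2.
split=> //; last first.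
  have := q0_conj_pure (conjq a) x0; rewrite conjqK ey q0_scal => /eqP.
  by rewrite mulf_eq0 p2 (negPf pN0).
apply: (mulfI pN0); rewrite -p2 -PoszM -nx -exy !normqM normq_conj na p2.
by ring.
Qed.

(** From right to left one factor [p] comes from [g = a * d] with [conjq a * g = p d]. The second is
    [d * a = 0] modulo [p], by [swap_eq0]; its condition on [d * a * d] holds because
    [p^2 | normq g] forces [p | normq d]. *)
Lemma dvdq_sandwich g a : q0 g = 0 -> ~~ dvdq p g -> ((p ^ 2)%N %| normq g)%Z ->
  normq a = p%:Z ->
  dvdq (p ^ 2) (conjq a * g * a) = (redq F g * redq F a == 0).
Proof.
move=> g0 pg ng na; have [aN0 nra] := redq_norm_p p_pr p_odd na.
have p0 := prime_gt0 p_pr.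
have p2 : (p ^ 2)%N%:Z = p%:Z ^+ 2 by rewrite -mulnn PoszM.
have rg0 : q0 (redq F g) = 0 by rewrite /= g0.
have rgN0 : redq F g != 0 by rewrite redq_eq0.
have nrg : normq (redq F g) = 0.
  apply/eqP; rewrite normq_red -(dvdp_int p_pr); apply: dvdz_trans ng.
  by rewrite p2 dvdz_mulr.
apply/idP/eqP => [|ga].
  move=> /dvdqP[y ey]; apply/eqP.
  rewrite -(pure_sandwich (Fp2 p_pr p_odd) rg0 rgN0 nrg nra).
  rewrite -redq_conj -!redqM (redq_eq0 p_pr) ey; apply/dvdqP.
  by exists (scalq p%:Z * y); rewrite mulrA -scalqM p2.
have /dvdqP[d ed] : dvdq p (conjq a * g).
  rewrite -(redq_eq0 p_pr) redqM redq_conj -[redq F g]conjqK (conjq_pure rg0).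
  by rewrite conjqN mulrN -conjqM ga conjq0 oppr0.
have eg : g = a * d.
  by apply: (scalq_inj p0); rewrite -scalqCA -ed mulrA mulq_conj na.
rewrite ed -mulrA -mulnn dvdq_scalM // -(redq_eq0 p_pr) redqM; apply/eqP.
have nrd : normq (redq F d) = 0.
  apply/eqP; rewrite normq_red -(dvdp_int p_pr).
  move: ng; rewrite eg normqM na p2 expr2 dvdz_mul2l //; lia.
have rge : redq F g = redq F a * redq F d by rewrite eg redqM.
apply: (swap_eq0 (Fp2 p_pr p_odd)); rewrite -?rge //.
  by rewrite mulrA -rge ga.
rewrite -mulrA -rge -[redq F g]opprK -(conjq_pure rg0) rge conjqM mulrN mulrA.
by rewrite mulq_conj nrd mul0r oppr0.
Qed.

(** Unless [p^2] divides [g], either [g] or [g / p] is nonzero and isotropic modulo [p], and the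
    admissible [a] are those of norm [p] in its ideal. For [g / p], of norm [n], isotropy is the
    hypothesis [p | n]. *)
Lemma count_sandwich_dvd n g : (p %| n)%N -> q0 g = 0 ->
  normq g = (p ^ 2 * n)%:Z ->
  count (fun a => dvdq (p ^ 2) (conjq a * g * a)) (norm_list p) =
  if dvdq (p ^ 2) g then (8 * p.+1)%N else 8%N.
Proof.
move=> pn g0 ng; have p0 := prime_gt0 p_pr; have F2 := Fp2 p_pr p_odd.
have [|pg] := boolP (dvdq p g); last first.
  have rgN0 : redq F g != 0 by rewrite redq_eq0.
  have pdvd : ((p ^ 2)%N %| normq g)%Z by rewrite ng PoszM dvdz_mulr.
  rewrite ifN; last first.
    apply: contra pg => /dvdqP[y ->]; apply/dvdqP.
    by exists (scalq p%:Z * y); rewrite -mulnn PoszM scalqM mulrA.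
  rewrite -(count_annihilated p_pr p_odd (g := redq F g)) //=; first last.
  - apply/eqP; rewrite normq_red -(dvdp_int p_pr) ng -mulnn -mulnA PoszM.
    by rewrite dvdz_mulr.
  - by rewrite g0.
  apply: eq_in_count => a; rewrite mem_norm_list => /eqP na.
  exact: dvdq_sandwich.
case/dvdqP=> h eg; move: g0 ng; rewrite eg q0_scal => /eqP.
rewrite mulf_eq0 => /orP[/eqP|/eqP h0]; first by lia.
have p2 : (p ^ 2)%N%:Z = p%:Z ^+ 2 by rewrite -mulnn PoszM.
have pN0 : p%:Z ^+ 2 != 0 by rewrite expf_neq0 //; lia.
rewrite normqM normq_scal PoszM p2 => /(mulfI pN0) nh.
rewrite -mulnn dvdq_scalM //.
rewrite (eq_count (a2 := fun a => dvdq p (conjq a * h * a))); last first.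
  by move=> a; rewrite scalqCA -mulrA dvdq_scalM.
have [/dvdqP[y ->]|ph] := boolP (dvdq p h).
  rewrite -(size_norm_p p_pr p_odd); apply/eqP; rewrite -all_count.
  apply/allP => a _; apply/dvdqP; exists (conjq a * y * a).
  by rewrite scalqCA -mulrA.
have rh0 : q0 (redq F h) = 0 by rewrite /= h0.
have rhN0 : redq F h != 0 by rewrite redq_eq0.
have nrh : normq (redq F h) = 0.
  by apply/eqP; rewrite normq_red -(dvdp_int p_pr) nh dvdzE.
rewrite -(count_annihilated p_pr p_odd rh0 rhN0 nrh).
apply: eq_in_count => a; rewrite mem_norm_list => /eqP na.
have [aN0 nra] := redq_norm_p p_pr p_odd na.
by rewrite -(pure_sandwich F2) // -redq_conj -!redqM redq_eq0.
Qed.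

(** The count on the right stands for [r3(n / p^2)], in a form that is correctly 0 when [p^2] does
    not divide [n]. *)
Lemma r3_hecke n : (p %| n)%N ->
  (p.+1 * r3 n = r3 (p ^ 2 * n) + p *
    count (fun x => (q0 x == 0%R) && dvdq (p ^ 2) x) (norm_list (p ^ 2 * n)))%N.
Proof.
move=> pn; apply/eqP; rewrite -(eqn_pmul2l (m := 8)) // mulnA -size_norm_p //.
set L := norm_list (p ^ 2 * n).
have -> : (size (norm_list p) * r3 n = \sum_(a <- norm_list p) \sum_(g <- L)
    ((q0 g == 0%R) && dvdq (p ^ 2) (conjq a * g * a)%R))%N.
  rewrite big_seq (eq_bigr (fun=> r3 n)) => [|a]; last first.
    rewrite mem_norm_list => /eqP na; rewrite -(count_sandwich n na) -sum1_count.
    by rewrite [RHS]big_mkcond; apply: eq_bigr => g _; case: (_ && _).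
  by rewrite -big_seq big_const_seq count_predT iter_addn_0 mulnC.
rewrite exchange_big /=.
rewrite big_seq (eq_bigr (fun g => (8 * (q0 g == 0%R) +
  8 * p * ((q0 g == 0%R) && dvdq (p ^ 2) g))%N)) => [|g]; last first.
  rewrite mem_norm_list => /eqP ng.
  have [g0|gN0] := eqVneq (q0 g) 0; last by rewrite big1 ?muln0.
  transitivity (count (fun a => dvdq (p ^ 2) (conjq a * g * a)) (norm_list p)).
    rewrite -sum1_count [RHS]big_mkcond; apply: eq_bigr => a _ /=.
    by case: (dvdq _ _).
  by rewrite (count_sandwich_dvd pn g0 ng); case: ifP => _ /=; lia.
rewrite -big_seq big_split /= -!big_distrr /= mulnDr mulnA; apply/eqP.
rewrite /r3 -!sum1_count -/L; congr (_ + _)%N; congr (_ * _)%N;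
  by rewrite [RHS]big_mkcond; apply: eq_bigr => g _; case: ifP.
Qed.

Lemma r3_pow n k : ~~ (p %| n)%N ->
  r3 (p ^ (2 * k).+1 * n) = ((\sum_(i < k.+1) p ^ i) * r3 (p * n))%N.
Proof.
move=> pn; have p0 := prime_gt0 p_pr.
(* The recurrence has order two, so the induction carries two consecutive values. *)
suff : r3 (p ^ (2 * k).+1 * n) = ((\sum_(i < k.+1) p ^ i) * r3 (p * n))%N /\
  r3 (p ^ (2 * k.+1).+1 * n) = ((\sum_(i < k.+2) p ^ i) * r3 (p * n))%N by case.
have pdvd i : (p %| p ^ (2 * i).+1 * n)%N by rewrite expnS -mulnA dvdn_mulr.
have sq i : (p ^ 2 * (p ^ (2 * i).+1 * n))%N = (p ^ (2 * i.+1).+1 * n)%N.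
  by rewrite mulnA -expnD; congr (_ ^ _ * _)%N; lia.
elim: k => [|k [IH0 IH1]].
  split; first by rewrite big_ord1 mul1n.
  have := r3_hecke (pdvd 0); rewrite (eq_in_count (a2 := pred0)) => [|x].
    rewrite count_pred0 muln0 addn0 sq => <-; rewrite !big_ord_recl big_ord0 /=.
    by rewrite /bump /= addn0 expn0 expn1 add1n.
  rewrite mem_norm_list => /eqP nx; apply/negbTE/negP => /andP[_ /dvdqP[y ey]].
  case/negP: pn; move: nx; rewrite ey normqM normq_scal => /(congr1 absz).
  rewrite abszM abszX !absz_nat expn1 -[((p ^ 2) ^ 2)%N]mulnn -mulnA => /eqP.
  rewrite eqn_pmul2l ?expn_gt0 ?p0 // -mulnn -mulnA eqn_pmul2l // => /eqP <-.
  exact: dvdn_mulr.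
split=> //.
have := r3_hecke (pdvd k.+1).
rewrite [X in norm_list X](_ : _ = (p ^ 2) ^ 2 * (p ^ (2 * k).+1 * n))%N;
  last first.
  by rewrite -sq -[((p ^ 2) ^ 2)%N]mulnn !mulnA.
rewrite count_multiples ?expn_gt0 ?p0 // sq IH0 IH1 => e.
apply/eqP; rewrite -(eqn_add2r (p * ((\sum_(i < k.+1) p ^ i) * r3 (p * n)))) -e.
rewrite ![(\sum_(i < k.+3) _)%N]big_ord_recr.
rewrite ![(\sum_(i < k.+2) _)%N]big_ord_recr /=.
by apply/eqP; rewrite [(p ^ k.+2)%N]expnS; ring.
Qed.

End OddPrime.

(** * Shanks's identity and the inverse of the generating function *)

Section Shanks.
Variables (R : comPzRingType) (q : R).

Definition oddprod n : R := \prod_(j < n) (1 - q ^+ (2 * j).+1).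
Definition evenprod n : R := \prod_(1 <= j < n.+1) (1 - q ^+ (2 * j)).
Definition trisum n : R := \sum_(s < n) q ^+ 'C(s.+1, 2).
(** The term [s = 0] is [evenprod n]; every other term has a factor [q ^+ (2 * n).+1], so it alone
    survives in the limit. *)
Definition shanks_sum n : R := \sum_(s < n)
  (\prod_(s.+1 <= j < n.+1) (1 - q ^+ (2 * j))) * oddprod s *
    q ^+ (s * (2 * n).+1).

Lemma shanks_sumS n : shanks_sum n.+1 = (1 - q ^+ (2 * n).+1) * shanks_sum n +
  oddprod n.+1 * (q ^+ (n * (2 * n).+1) + q ^+ (n.+1 * (2 * n).+1)).
Proof.
(* The telescoping certificate: [g s.+1 - g s] is the [s]-th term for [n.+1] minus
   [1 - q ^+ (2 * n).+1] times the one for [n]. The product starts at [s], so [g 0] contains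
   [1 - q ^+ 0] and vanishes. *)
pose g s := (\prod_(s <= j < n.+1) (1 - q ^+ (2 * j))) * oddprod s *
  q ^+ (s * (2 * n).+1).
have e3 : (2 * n.+1 = (2 * n).+2)%N by lia.
have e4 : (q ^+ (2 * n).+1 = q * q ^+ (2 * n)) /\
    (q ^+ (2 * n).+2 = q * (q * q ^+ (2 * n))) by rewrite !exprS.
have step (s : nat) : (s < n)%N -> g s.+1 - g s =
    (\prod_(s.+1 <= j < n.+2) (1 - q ^+ (2 * j))) * oddprod s *
      q ^+ (s * (2 * n.+1).+1) -
    (1 - q ^+ (2 * n).+1) * ((\prod_(s.+1 <= j < n.+1) (1 - q ^+ (2 * j))) *
      oddprod s * q ^+ (s * (2 * n).+1)).
  move=> sn; rewrite /g [in LHS](@big_ltn _ _ _ s n.+1); last by lia.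
  rewrite (@big_nat_recr _ _ _ n.+1 s.+1) /=; last by lia.
  rewrite [oddprod s.+1]big_ord_recr -/(oddprod s) /=.
  move: (\prod_(_ <= _ < _) _) (oddprod s) => u d.
  have e1 : (s * (2 * n.+1).+1 = s * (2 * n).+1 + 2 * s)%N by lia.
  have e2 : (s.+1 * (2 * n).+1 = s * (2 * n).+1 + (2 * n).+1)%N by lia.
  rewrite e1 e2 e3 !(exprD q (s * (2 * n).+1)) !(exprS q (2 * s)) !e4.1 !e4.2.
  by ring.
have := telescope_sumr g (leq0n n); rewrite big_mkord.
rewrite (eq_bigr _ (fun (s : 'I_n) _ => step s (ltn_ord s))) sumrB -big_distrr /=.
rewrite -/(shanks_sum n) => tel.
rewrite /shanks_sum big_ord_recr /= big_nat1.
rewrite -[X in X + _](subrK ((1 - q ^+ (2 * n).+1) * shanks_sum n)) tel.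
have -> : g 0 = 0 by rewrite /g big_ltn // mulrBl expr0 subrr !mul0r.
rewrite /g big_nat1 [oddprod n.+1]big_ord_recr -/(oddprod n) /=.
have -> : (n * (2 * n.+1).+1 = n * (2 * n).+1 + 2 * n)%N by lia.
have -> : (n.+1 * (2 * n).+1 = n * (2 * n).+1 + (2 * n).+1)%N by lia.
by rewrite -/(shanks_sum n) e3 !(exprD q (n * (2 * n).+1)) e4.1 e4.2; ring.
Qed.

Lemma bin2_double n : ('C((2 * n).+1, 2) = n * (2 * n).+1)%N /\
  ('C((2 * n).+2, 2) = n.+1 * (2 * n).+1)%N.
Proof. by rewrite !bin2 /=; split; nia. Qed.

Lemma shanks n : oddprod n * trisum (2 * n) = shanks_sum n.
Proof.
elim: n => [|n IH]; first by rewrite /trisum /shanks_sum !big_ord0 mulr0.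
rewrite shanks_sumS -IH mulnS /trisum !big_ord_recr /=.
have [-> ->] := bin2_double n.
by rewrite [oddprod n.+1]big_ord_recr -/(oddprod n) /=; ring.
Qed.

End Shanks.

(** * Polynomials as truncated power series *)

Section Congruence.
Variable F : fieldType.
Implicit Types p r s : {poly F}.

Definition eqX (K : nat) p r : bool := 'X^K %| p - r.

Lemma eqXX K p : eqX K p p.
Proof. by rewrite /eqX subrr dvdp0. Qed.
Lemma eqX_sym K p r : eqX K p r -> eqX K r p.
Proof. by rewrite /eqX -opprB dvdpNr. Qed.
Lemma eqX_trans K p r s : eqX K p r -> eqX K r s -> eqX K p s.
Proof.
by move=> pr rs; rewrite /eqX -(subrK r p) -addrA dvdp_add.
Qed.
Lemma eqXM K p p' r r' : eqX K p r -> eqX K p' r' -> eqX K (p * p') (r * r').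
Proof.
move=> pr pr'; rewrite /eqX.
have -> : p * p' - r * r' = (p - r) * p' + r * (p' - r') by ring.
by apply: dvdp_add; [exact: dvdp_mulr | exact: dvdp_mull].
Qed.
Lemma eqX_le K K' p r : (K <= K')%N -> eqX K' p r -> eqX K p r.
Proof. by move=> KK; apply/dvdp_trans/dvdp_exp2l. Qed.
Lemma eqX_prod K (I : eqType) (t : seq I) (P : pred I) (f g : I -> {poly F}) :
  (forall i, i \in t -> P i -> eqX K (f i) (g i)) ->
  eqX K (\prod_(i <- t | P i) f i) (\prod_(i <- t | P i) g i).
Proof.
move=> fg; rewrite big_seq_cond [X in eqX _ _ X]big_seq_cond.
elim/big_ind2: _ => [|p p' r r'|i /andP[it Pi]]; [exact: eqXX|exact: eqXM|].
exact: fg.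
Qed.
Lemma eqXP K p r : reflect (forall i, (i < K)%N -> p`_i = r`_i) (eqX K p r).
Proof.
apply: (iffP idP) => [/dvdpP[u e] i iK|e].
  by apply/eqP; rewrite -subr_eq0 -coefB e coefMXn iK.
apply/dvdpP; exists (\poly_(i < size (p - r)) (p - r)`_(i + K)).
apply/polyP => i; rewrite coefMXn coef_poly.
case: ltnP => iK; first by rewrite coefB e // subrr.
rewrite subnK //; case: ltnP => // h.
by rewrite nth_default // (leq_trans h) ?leq_subr.
Qed.
Lemma eqX_mulI K p r s : p`_0 != 0 -> eqX K (p * r) (p * s) -> eqX K r s.
Proof.
move=> p0; rewrite /eqX -mulrBr Gauss_dvdpr //.
rewrite coprimep_expl // coprimep_sym coprimepX /root.
by rewrite horner_coef0.
Qed.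
Lemma eqX1_exp K d : (K <= d)%N -> eqX K (1 - 'X^d) 1.
Proof. by move=> Kd; rewrite /eqX addrAC subrr sub0r dvdpNr dvdp_exp2l. Qed.

End Congruence.

Section PodSeries.
Variables (F : fieldType) (n : nat).

(** The generating product at [-X], with multiplicities cut at [n]. The sign turns the factors
    [1 + q^(2i-1)] into those of [oddprod]. *)
Definition podpoly : {poly F} := \prod_(i < n)
  \sum_(k < n.+1 | odd i.+1 ==> (k <= 1)%N) (- 'X) ^+ (k * i.+1).

Lemma coef_podpoly : podpoly`_n = (-1) ^+ n * (pod n)%:R.
Proof.
rewrite /podpoly bigA_distr_big_dep coef_sum /pod -sum1_card natr_sum mulr_sumr.
rewrite big_mkcond [RHS]big_mkcond /=; apply: eq_bigr => m _.
rewrite [X in _ = if X then _ else _]inE andbC /is_partition.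
rewrite -[X in if X then _ else _]/(odd_parts_distinct m).
case: odd_parts_distinct => //=; rewrite prodrXr (exprNn 'X).
have -> : -1 = (-1)%:P :> {poly F} by rewrite polyCN.
rewrite -polyC_exp coefCM coefXn eq_sym.
by case: eqP => [->|_]; rewrite ?mulr1 ?mulr0.
Qed.

Lemma podpoly_even : eqX n.+1
  (podpoly * \prod_(i < n | ~~ odd i.+1) (1 - 'X^(i.+1)))
  (\prod_(i < n | odd i.+1) (1 - 'X^(i.+1))).
Proof.
rewrite /podpoly [X in _ * X]big_mkcond [X in eqX _ _ X]big_mkcond -big_split /=.
apply: eqX_prod => i _ _; have ilt := ltn_ord i.
have sgn k : (- 'X) ^+ (k * i.+1) = ((-1) ^+ i.+1 * 'X^(i.+1)) ^+ k :> {poly F}.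
  by rewrite mulnC exprM (exprNn 'X).
under eq_bigr => k _ do rewrite sgn.
rewrite -signr_odd /=; case: (odd i) => /=.
  rewrite expr0 mul1r mulrC -opprB mulNr -subrX1 opprB -exprM.
  by apply: eqX1_exp; nia.
rewrite mulr1 -(big_mkord (fun k => (k <= 1)%N)
  (fun k => ((-1) ^+ true * 'X^(i.+1)) ^+ k)).
rewrite (@big_cat_nat _ _ _ 2) //=; last by lia.
rewrite [X in _ + X]big_nat_cond [X in _ + X]big1 ?addr0; last first.
  by move=> k /andP[/andP[k2 _] k1]; move: (leq_trans k2 k1).
by rewrite big_mkcond !big_nat_recl //= big_nil addr0 !expr1 expr0 mulN1r eqXX.
Qed.

Lemma oddprodE N : \prod_(0 <= i < N.*2 | odd i.+1) (1 - 'X^(i.+1)) =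
  oddprod 'X N :> {poly F}.
Proof.
elim: N => [|N IH]; first by rewrite /oddprod big_ord0 big_geq.
rewrite doubleS big_mkcond !big_nat_recr //= -big_mkcond IH.
by rewrite odd_double /= mulr1 /oddprod [RHS]big_ord_recr [(2 * ord_max)%N]mul2n.
Qed.

Lemma evenprodE N : \prod_(0 <= i < N.*2 | ~~ odd i.+1) (1 - 'X^(i.+1)) =
  evenprod 'X N :> {poly F}.
Proof.
elim: N => [|N IH]; first by rewrite /evenprod !big_geq.
rewrite doubleS big_mkcond !big_nat_recr //= -big_mkcond IH.
by rewrite odd_double /= mulr1 /evenprod [RHS]big_nat_recr // [(2 * N.+1)%N]mul2n.
Qed.

Lemma eqX_prod_trunc N (P : pred nat) : (n <= N)%N ->
  eqX n.+1 (\prod_(0 <= i < N | P i) (1 - 'X^(i.+1)) : {poly F})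
    (\prod_(i < n | P i) (1 - 'X^(i.+1))).
Proof.
move=> nN; rewrite (@big_cat_nat _ _ _ n) //= big_mkord -[X in eqX _ _ X]mulr1.
apply: eqXM; first exact: eqXX.
apply: (@eqX_trans _ _ _ (\prod_(n <= i < N | P i) 1)); last first.
  by rewrite big1 // eqXX.
by apply: eqX_prod => i; rewrite mem_index_iota => /andP[ni _] _; apply: eqX1_exp.
Qed.

Lemma oddprod0 N : (oddprod 'X N : {poly F})`_0 = 1.
Proof.
rewrite -horner_coef0 /oddprod horner_prod big1 // => i _.
by rewrite !hornerE /= expr0n subr0.
Qed.

Lemma shanks_sum_evenprod N : eqX (2 * N).+1 (shanks_sum 'X N.+1) 
  (evenprod 'X N.+1 : {poly F}).
Proof.
rewrite /shanks_sum big_ord_recl /= /oddprod big_ord0 mulr1 mul0n expr0 mulr1.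
rewrite /eqX addrAC subrr add0r; elim/big_rec: _ => [|i u _ hu].
  exact: dvdp0.
apply: dvdp_add hu; apply/dvdp_mull/dvdp_exp2l; rewrite /bump /=; nia.
Qed.

Lemma podpoly_inverse N : (n <= 2 * N)%N ->
  eqX n.+1 (podpoly * trisum 'X (2 * N.+1)) 1.
Proof.
move=> nN; apply: (@eqX_mulI _ _ (oddprod 'X N.+1)).
  by rewrite oddprod0 oner_eq0.
have nN' : (n <= N.+1.*2)%N by lia.
rewrite mulr1 mulrCA shanks.
apply: (@eqX_trans _ _ _ (podpoly * evenprod 'X N.+1)).
  by apply: eqXM (eqXX _ _) _; apply: eqX_le (shanks_sum_evenprod N); lia.
rewrite -evenprodE -oddprodE.
apply: (eqX_trans _ (eqX_sym (eqX_prod_trunc (fun i => odd i.+1) nN'))).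
apply: eqX_trans podpoly_even.
by apply: eqXM (eqXX _ _) _; apply: (eqX_prod_trunc (fun i => ~~ odd i.+1) nN').
Qed.

End PodSeries.

(** * The theta series of odd squares and its 5-dissection *)

(** Both signs are kept because multiplication by [2 + i] does not preserve positivity and because
    [r3] counts signed representations; the theta series becomes twice the triangular one. *)
Definition odd_box (L : nat) : seq int :=
  [seq (2 * a).+1%:Z | a <- iota 0 L] ++ [seq - (2 * a).+1%:Z | a <- iota 0 L].

Lemma mem_odd_box L z : (z \in odd_box L) = odd (absz z) && (absz z < 2 * L)%N.
Proof.
rewrite mem_cat; apply/orP/andP => [[]/mapP[a]|[oz zL]].
- by rewrite mem_iota => ? ->; split; lia.
- by rewrite mem_iota => ? ->; split; lia.
have [z0|z0] := lerP 0 z; [left|right]; apply/mapP; exists (absz z)./2;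
  rewrite ?mem_iota; lia.
Qed.

Lemma odd_box_uniq L : uniq (odd_box L).
Proof.
rewrite cat_uniq !map_inj_uniq ?iota_uniq //=; try by move=> a b; lia.
rewrite andbT; apply/hasPn => z /mapP[a _ ->]; apply/negP => /mapP[b _]; lia.
Qed.

(* For odd [z] this is the triangular number [(z ^ 2 - 1) / 8]. *)
Definition tri_exp (z : int) : nat := ((absz z ^ 2).-1 %/ 8)%N.

Lemma odd_sqr (z : int) : odd (absz z) -> exists t, z ^+ 2 = 8%:Z * t + 1.
Proof.
move=> oz; have [a ->] : exists a, z = 2 * a + 1 by exists (z %/ 2)%Z; lia.
have [b [eb|eb]] : exists b, a = 2 * b \/ a = 2 * b + 1.
  by exists (a %/ 2)%Z; lia.
- by exists (2 * b ^+ 2 + b); rewrite eb; ring.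
- by exists (2 * b ^+ 2 + 3%:Z * b + 1); rewrite eb; ring.
Qed.

Lemma even_sqr (z : int) : ~~ odd (absz z) -> exists t, z ^+ 2 = 4%:Z * t.
Proof.
move=> oz; exists ((z %/ 2)%Z ^+ 2); have {1}-> : z = 2 * (z %/ 2)%Z by lia.
ring.
Qed.

Lemma tri_expE z : odd (absz z) -> (8 * tri_exp z + 1)%N%:Z = z ^+ 2.
Proof.
move=> oz; have [t et] := odd_sqr oz; rewrite /tri_exp.
have e : (absz z ^ 2)%N%:Z = z ^+ 2 by rewrite -abszX gez0_abs ?sqr_ge0.
by rewrite et in e *; lia.
Qed.

Lemma tri_exp_odd a : tri_exp (2 * a).+1 = 'C(a.+1, 2) /\
  tri_exp (- (2 * a).+1%:Z) = 'C(a.+1, 2).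
Proof.
have -> : tri_exp (- (2 * a).+1%:Z) = tri_exp (2 * a).+1.
  by rewrite /tri_exp abszN.
suff -> : tri_exp (2 * a).+1 = 'C(a.+1, 2) by [].
have o : odd (absz (2 * a).+1) by lia.
by have := tri_expE o; rewrite bin2 /=; nia.
Qed.

Definition res14 (z : int) := ((z %% 5)%Z == 1) || ((z %% 5)%Z == 4%:Z).
Definition res23 (z : int) := ((z %% 5)%Z == 2) || ((z %% 5)%Z == 3%:Z).
Definition res0 (z : int) := (z %% 5)%Z == 0.

(* Multiplication by [2 + i] maps the solutions of [x^2 + y^2 = M] onto the
   solutions of [X^2 + Y^2 = 5M] with [X = 2Y] modulo 5; swapping the
   coordinates when needed makes [X^2] equal to 0 or 1 modulo 5. *)
Definition gauss_mul (u : int * int) : int * int :=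
  let: (z, w) := (2 * u.1 - u.2, u.1 + 2 * u.2) in
  if res23 z then (w, z) else (z, w).
Definition gauss_div (u : int * int) : int * int :=
  let: (z, w) := if (5 %| u.1 - 2 * u.2)%Z then u else (u.2, u.1) in
  (((2 * z + w) %/ 5)%Z, ((2 * w - z) %/ 5)%Z).

Lemma gauss_divK z w : res14 z && res23 w || res0 z && res0 w ->
  let u := gauss_div (z, w) in
  5%:Z * (u.1 ^+ 2 + u.2 ^+ 2) = z ^+ 2 + w ^+ 2 /\ gauss_mul u = (z, w).
Proof.
have div5 (a b : int) : (5 %| a - 2 * b)%Z ->
    exists x y, [/\ a = 2 * x - y, b = x + 2 * y,
      ((2 * a + b) %/ 5)%Z = x & ((2 * b - a) %/ 5)%Z = y].
  move=> ab; exists ((2 * a + b) %/ 5)%Z, ((2 * b - a) %/ 5)%Z; split=> //; lia.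
rewrite /gauss_div /gauss_mul /res14 /res23 /res0 => c /=.
case: ifP => [/div5|zw] /=.
  case=> x [y [ez ew -> ->]] /=; rewrite -ez -ew; split.
    by rewrite ez ew; ring.
  by rewrite ifN //; lia.
have /div5[x [y [ew ez -> ->]]] : (5 %| w - 2 * z)%Z by lia.
rewrite -ez -ew; split; first by rewrite ez ew; ring.
by rewrite ifT //; lia.
Qed.

Lemma gauss_mulK x y : let u := gauss_mul (x, y) in
  [/\ u.1 ^+ 2 + u.2 ^+ 2 = 5%:Z * (x ^+ 2 + y ^+ 2),
     res14 u.1 && res23 u.2 || res0 u.1 && res0 u.2 & gauss_div u = (x, y)].
Proof.
rewrite /gauss_div /gauss_mul /=; case: ifP => c /=; split.
- ring.
- by move: c; rewrite /res14 /res23 /res0; lia.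
- rewrite ifN; last by move: c; rewrite /res23; lia.
  by congr (_, _); lia.
- ring.
- by move: c; rewrite /res14 /res23 /res0; lia.
rewrite ifT; last by lia.
by congr (_, _); lia.
Qed.

Lemma two_odd_squares L i x y : (4 * i + 2 <= L)%N ->
  x ^+ 2 + y ^+ 2 = (8 * i + 2)%N%:Z ->
  (tri_exp x + tri_exp y = i)%N /\ x \in odd_box L /\ y \in odd_box L.
Proof.
move=> iL e; have sx := sqr_ge0 x; have sy := sqr_ge0 y.
have [ox oy] : odd (absz x) /\ odd (absz y).
  move: e; case: (boolP (odd (absz x))) => [/odd_sqr|/even_sqr] [t1 ->];
  case: (boolP (odd (absz y))) => [/odd_sqr|/even_sqr] [t2 ->];
  by first [done | lia].
have bound (z : int) : z ^+ 2 <= (8 * i + 2)%N%:Z -> (absz z < 2 * L)%N.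
  by move=> zm; have := le_sqr z; lia.
rewrite !mem_odd_box ox oy !bound /= -?e; [|lra|lra].
by split=> //; move: e; rewrite -!tri_expE // -!PoszD => -[]; lia.
Qed.

Section Theta.
Variable F : fieldType.

Definition theta (L : nat) (P : pred int) : {poly F} :=
  \sum_(z <- odd_box L | P z) 'X^(tri_exp z).

Lemma theta_trisum L : theta L predT = trisum 'X L *+ 2.
Proof.
have e : iota 0 L = index_iota 0 L by rewrite /index_iota subn0.
rewrite /theta big_cat !big_map /= e !big_mkord mulr2n.
by congr (_ + _); apply: eq_bigr => i _; congr ('X^_);
  have [e1 e2] := tri_exp_odd i.
Qed.

Definition pairs (T U : Type) (s : seq T) (t : seq U) :=
  [seq (x, y) | x <- s, y <- t].

Lemma coef_expsum (T : Type) (s : seq T) (P : pred T) (f : T -> nat) j :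
  (\sum_(x <- s | P x) 'X^(f x) : {poly F})`_j =
  (count (fun x => P x && (f x == j)) s)%:R.
Proof.
rewrite coef_sum -sum1_count natr_sum [RHS]big_mkcondr /=.
by apply: eq_bigr => x _; rewrite coefXn eq_sym; case: eqP.
Qed.

Lemma mul_expsum (T U : Type) (s : seq T) (t : seq U) (P : pred T) (Q : pred U)
    (f : T -> nat) (g : U -> nat) :
  (\sum_(x <- s | P x) 'X^(f x)) * (\sum_(y <- t | Q y) 'X^(g y)) =
  \sum_(u <- pairs s t | P u.1 && Q u.2) 'X^(f u.1 + g u.2) :> {poly F}.
Proof.
rewrite [RHS]big_mkcond big_allpairs /= mulr_suml big_mkcond.
apply: eq_bigr => x _; case: (P x) => /=; last by rewrite big1.
rewrite mulr_sumr big_mkcond; apply: eq_bigr => y _.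
by case: (Q y); rewrite ?exprD.
Qed.

Lemma mem_pairs (T U : eqType) (s : seq T) (t : seq U) u :
  (u \in pairs s t) = (u.1 \in s) && (u.2 \in t).
Proof.
apply/allpairsP/andP => [[v [vs vt ->]] //|[us ut]].
by exists u; split=> //; case: u {us ut}.
Qed.

Lemma pairs_uniq (T U : eqType) (s : seq T) (t : seq U) :
  uniq s -> uniq t -> uniq (pairs s t).
Proof. by move=> us ut; apply: allpairs_uniq => // -[a b] [c d]. Qed.

(** Squares are 0 or 1 modulo 4, so three of them add up to [8m + 3] only when all are odd. *)
Lemma coef_theta3 L m : (4 * m + 2 <= L)%N ->
  (theta L predT ^+ 3)`_m = (r3 (8 * m + 3))%:R.
Proof.
move=> mL; rewrite !exprSr expr0 mul1r /theta !mul_expsum coef_expsum.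
congr (_%:R).
rewrite /r3 -!size_filter; have uL := odd_box_uniq L.
apply: (size_bij (f := fun u => Quat 0 u.1.1 u.1.2 u.2)
  (g := fun x => ((q1 x, q2 x), q3 x))).
- by rewrite filter_uniq ?pairs_uniq.
- by rewrite filter_uniq ?norm_list_uniq.
- move=> [[x y] z].
  rewrite mem_filter_norm mem_filter !mem_pairs !mem_odd_box /=.
  case/and3P=> /eqP e /andP[/andP[ox _] /andP[oy _]] /andP[oz _].
  rewrite /normq [q0 _]/= [q1 _]/= [q2 _]/= [q3 _]/= expr0n add0r.
  rewrite -!tri_expE // -!PoszD; split=> //.
  by apply/eqP; congr Posz; lia.
move=> x; rewrite mem_filter_norm mem_filter !mem_pairs !mem_odd_box /=.
case/andP=> /eqP x0 /eqP; rewrite /normq x0 expr0n add0r => nx.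
have bound (z : int) : z ^+ 2 <= (8 * m + 3)%N%:Z -> (absz z < 2 * L)%N.
  by move=> zm; have := le_sqr z; lia.
have s1 := sqr_ge0 (q1 x); have s2 := sqr_ge0 (q2 x); have s3 := sqr_ge0 (q3 x).
have [o1 o2 o3] : [/\ odd (absz (q1 x)), odd (absz (q2 x)) & odd (absz (q3 x))].
  move: nx; case: (boolP (odd (absz (q1 x)))) => [/odd_sqr|/even_sqr] [t1 ->];
  case: (boolP (odd (absz (q2 x)))) => [/odd_sqr|/even_sqr] [t2 ->];
  case: (boolP (odd (absz (q3 x)))) => [/odd_sqr|/even_sqr] [t3 ->];
  first [done | lia].
have b1 : (absz (q1 x) < 2 * L)%N by apply: bound; rewrite -nx; lra.
have b2 : (absz (q2 x) < 2 * L)%N by apply: bound; rewrite -nx; lra.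
have b3 : (absz (q3 x) < 2 * L)%N by apply: bound; rewrite -nx; lra.
rewrite o1 o2 o3 b1 b2 b3 andbT; split; last by apply: quatP.
by move: nx; rewrite -!tri_expE // -!PoszD => -[]; rewrite andbT; lia.
Qed.

Lemma tri_exp_mod5 z : odd (absz z) ->
  [/\ res14 z -> (tri_exp z %% 5 = 0)%N, res23 z -> (tri_exp z %% 5 = 1)%N
    & res0 z -> (tri_exp z %% 5 = 3)%N].
Proof.
move=> /tri_expE; rewrite /res14 /res23 /res0.
have [u ->] : exists u, z ^+ 2 = 5%:Z * u + (z %% 5)%Z ^+ 2.
  exists (5%:Z * (z %/ 5)%Z ^+ 2 + 2 * (z %/ 5)%Z * (z %% 5)%Z).
  by rewrite {1}(divz_eq z 5); ring.
move=> e; split=> [/orP[]|/orP[]|] /eqP r; rewrite r in e; lia.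
Qed.

Lemma theta_split L :
  theta L predT = theta L res14 + theta L res23 + theta L res0.
Proof.
rewrite /theta -addrA (bigID res14) /=; congr (_ + _).
rewrite (bigID res23) /=; congr (_ + _); apply: eq_bigl => z;
  rewrite /res14 /res23 /res0; lia.
Qed.

(** The operator [U_5] after a shift: it keeps the exponents congruent to [r] modulo 5 and is linear
    over polynomials in [X^5]. *)
Definition decim (r : nat) (p : {poly F}) : {poly F} :=
  \poly_(i < size p) p`_(5 * i + r).

Lemma coef_decim r p i : (decim r p)`_i = p`_(5 * i + r).
Proof.
rewrite coef_poly; case: ltnP => // h.
by rewrite nth_default // (leq_trans h) //; lia.
Qed.

Lemma decimD r p q : decim r (p + q) = decim r p + decim r q.
Proof. by apply/polyP => i; rewrite coefD !coef_decim coefD. Qed.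

Lemma decimZ r c p : decim r (c *: p) = c *: decim r p.
Proof. by apply/polyP => i; rewrite coefZ !coef_decim coefZ. Qed.

Lemma decim_comp r p q : (r < 5)%N ->
  decim r (p * (q \Po 'X^5)) = decim r p * q.
Proof.
move=> r5; elim/poly_ind: q => [|q c IH].
  by rewrite comp_poly0 !mulr0; apply/polyP => i; rewrite coef_decim !coef0.
rewrite comp_polyD comp_polyM comp_polyX comp_polyC !mulrDr decimD.
congr (_ + _); last by rewrite ![_ * _%:P]mulrC !mul_polyC decimZ.
rewrite [p * _]mulrA [RHS]mulrA -IH; apply/polyP => i.
rewrite coef_decim coefMXn coefMX coef_decim.
case: i => [|i] /=; first by rewrite muln0 add0n r5.
by rewrite ifN; [congr (_`_ _) | ]; lia.
Qed.

Lemma decimXn r j : (j < 5)%N -> decim r 'X^j = (r == j)%:R%:P :> {poly F}.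
Proof.
move=> j5; apply/polyP => i; rewrite coef_decim coefXn coefC.
case: i => [|i] /=; first by rewrite muln0.
by have -> : (5 * i.+1 + r == j)%N = false by lia.
Qed.

Lemma decim_shift (r j : nat) q : (r < 5)%N -> (j < 5)%N ->
  decim r ('X^j * (q \Po 'X^5)) = if r == j then q else 0.
Proof.
move=> r5 j5; rewrite decim_comp // decimXn //.
by case: eqP; rewrite (mul1r, mul0r).
Qed.

Lemma decim_id (r : nat) (p : {poly F}) : (r < 5)%N ->
  (forall i, p`_i != 0 -> (i %% 5 = r)%N) ->
  p = 'X^r * (decim r p \Po 'X^5).
Proof.
move=> r5 pr; apply/polyP => i; rewrite coefXnM coef_comp_poly_Xn //.
have [e|e] := eqVneq (i %% 5)%N r.
  have h : (5 * ((i - r) %/ 5) + r = i)%N by lia.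
  have -> : (i < r)%N = false by lia.
  have -> : (5 %| i - r)%N by lia.
  by rewrite coef_decim h.
have -> : p`_i = 0 by apply/eqP/negPn/negP => /pr; apply/eqP.
by case: ltnP => // ri; rewrite ifN //; lia.
Qed.

Lemma eqX_decim m r p q : eqX (5 * m + r).+1 p q ->
  eqX m.+1 (decim r p) (decim r q).
Proof.
move=> /eqXP h; apply/eqXP => i im; rewrite !coef_decim h //; lia.
Qed.

Lemma theta_decim L (P : pred int) r : (r < 5)%N ->
  (forall z, odd (absz z) -> P z -> (tri_exp z %% 5 = r)%N) ->
  theta L P = 'X^r * (decim r (theta L P) \Po 'X^5).
Proof.
move=> r5 Pr; apply: decim_id => // i; rewrite coef_expsum => h.
have /hasP[z] : has (fun z => P z && (tri_exp z == i)) (odd_box L).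
  by rewrite has_count lt0n; apply: contra_neq h => ->.
by rewrite mem_odd_box => /andP[oz _] /andP[Pz /eqP <-]; apply: Pr.
Qed.

(** Since [5 (8i + 2) = 8 (5i + 1) + 2], [gauss_mul] matches the pairs counted on the right with
    those on the left. It yields only one order of each mixed pair, hence the product of [res14] and
    [res23] without a factor 2. *)
Lemma coef_theta_gauss L i : (4 * (5 * i + 1) + 2 <= L)%N ->
  (theta L res14 * theta L res23 + theta L res0 ^+ 2)`_(5 * i + 1) =
  (theta L predT ^+ 2)`_i.
Proof.
move=> iL; rewrite coefD !expr2 /theta !mul_expsum !coef_expsum -natrD.
rewrite -count_predUI [X in (_ + X)%N](_ : _ = 0)%N; last first.
  rewrite (eq_count (a2 := pred0)) ?count_pred0 // => u /=.
  by rewrite /res14 /res0; lia.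
rewrite addn0; congr (_%:R); rewrite -!size_filter.
have uL := odd_box_uniq L.
apply: (size_bij (f := gauss_div) (g := gauss_mul));
  rewrite ?filter_uniq ?pairs_uniq // => u; rewrite !mem_filter !mem_pairs.
  case: u => z w /andP[/= cond /andP[zL wL]].
  have c : res14 z && res23 w || res0 z && res0 w.
    by case/orP: cond => /andP[-> _]; rewrite ?orbT.
  have e : (tri_exp z + tri_exp w = 5 * i + 1)%N.
    by case/orP: cond => /andP[_ /eqP].
  have := gauss_divK c; case: (gauss_div _) => x y /= [n ->]; split=> //.
  have [oz ow] : odd (absz z) /\ odd (absz w).
    by move: zL wL; rewrite !mem_odd_box => /andP[-> _] /andP[-> _].
  move: n; rewrite -(tri_expE oz) -(tri_expE ow) => n.
  by have [||-> [-> ->]] := @two_odd_squares L i x y; [lia|lia|rewrite eqxx].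
case: u => x y /andP[/= /eqP e /andP[xL yL]].
have [] := gauss_mulK x y; case: (gauss_mul _) => z w /= n c ->; split=> //.
have [ox oy] : odd (absz x) /\ odd (absz y).
  by move: xL yL; rewrite !mem_odd_box => /andP[-> _] /andP[-> _].
move: n; rewrite -(tri_expE ox) -(tri_expE oy) => n.
have [||ez [zL wL]] := @two_odd_squares L (5 * i + 1) z w; [lia|lia|].
by rewrite zL wL ez eqxx !andbT c.
Qed.

End Theta.

(** * Reduction of [pod] modulo 5 to sums of three squares *)

Section Mod5.
Local Notation F := 'F_5.

Lemma poly5 : 5%:R = 0 :> {poly F}.
Proof. by rewrite -polyC_natr (_ : 5%:R = 0) //; apply/eqP. Qed.

Lemma theta_frobenius L P : theta F L P ^+ 5 = theta F L P \Po 'X^5.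
Proof.
have ch : 5%N \in [pchar {poly F}] by rewrite inE /= poly5 eqxx.
have add5 (p q : {poly F}) : (p + q) ^+ 5 = p ^+ 5 + q ^+ 5.
  by rewrite exprDn_pchar // pnatE.
rewrite /theta (big_morph (fun p => p ^+ 5) add5 (id1 := 0)) ?expr0n //.
rewrite (raddf_sum (comp_poly 'X^5)) /=; apply: eq_bigr => z _.
by rewrite comp_Xn_poly -!exprM mulnC.
Qed.

Lemma decim_theta4 L : decim 2 (theta F L predT ^+ 4) =
  decim 1 (theta F L res14 * theta F L res23 + theta F L res0 ^+ 2) ^+ 2.
Proof.
rewrite theta_split.
have eA : theta F L res14 = decim 0 (theta F L res14) \Po 'X^5.
  rewrite {1}(@theta_decim F L res14 0) ?mul1r // => z oz.
  by have [] := tri_exp_mod5 oz.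
have eB : theta F L res23 = 'X^1 * (decim 1 (theta F L res23) \Po 'X^5).
  by apply: theta_decim => // z oz; have [] := tri_exp_mod5 oz.
have eC : theta F L res0 = 'X^3 * (decim 3 (theta F L res0) \Po 'X^5).
  by apply: theta_decim => // z oz; have [] := tri_exp_mod5 oz.
rewrite eA eB eC.
move: (decim 0 _) (decim 1 _) (decim 3 _) => a b c.
pose v := a * b + 'X * c ^+ 2.
have -> : (a \Po 'X^5) * ('X^1 * (b \Po 'X^5)) + ('X^3 * (c \Po 'X^5)) ^+ 2 =
    'X^1 * (v \Po 'X^5).
  by rewrite /v comp_polyD !comp_polyM comp_polyX; ring.
rewrite [in RHS]decim_shift //=.
(* Writing [A], [B], [C] for the three parts, with exponents 0, 1, 3 modulo 5, the terms of the
   fourth power in class 2 are [6 A^2 B^2 + 12 A B C^2 + C^4]. This is [(A B + C^2)^2] plus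
   [5 (A^2 B^2 + 2 A B C^2)]; the last bracket is [X^2 W]. *)
have [R0 [R1 [R3 [R4 [W ->]]]]] : exists R0 R1 R3 R4 W : {poly F},
  ((a \Po 'X^5) + 'X^1 * (b \Po 'X^5) + 'X^3 * (c \Po 'X^5)) ^+ 4 =
  'X^0 * (R0 \Po 'X^5) + 'X^1 * (R1 \Po 'X^5) + 'X^2 * ((v ^+ 2) \Po 'X^5) +
  'X^3 * (R3 \Po 'X^5) + 'X^4 * (R4 \Po 'X^5) + 5%:R * ('X^2 * W).
  exists (a ^+ 4 + 'X * (a * b ^+ 2 * c) *+ 12 + 'X ^+ 2 * (b * c ^+ 3) *+ 4).
  exists ((a ^+ 3 * b) *+ 4 + 'X * (a ^+ 2 * c ^+ 2) *+ 6 +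
    'X * (b ^+ 3 * c) *+ 4).
  exists ((a ^+ 3 * c) *+ 4 + (a * b ^+ 3) *+ 4 + 'X * (b ^+ 2 * c ^+ 2) *+ 6).
  exists ((a ^+ 2 * b * c) *+ 12 + 'X * (a * c ^+ 3) *+ 4 + b ^+ 4).
  exists ((a \Po 'X^5) ^+ 2 * (b \Po 'X^5) ^+ 2 +
    'X^5 * ((a \Po 'X^5) * (b \Po 'X^5) * (c \Po 'X^5) ^+ 2) *+ 2).
  rewrite /v !comp_polyD !comp_polyM !comp_polyD !comp_polyM !comp_polyX.
  by move: (a \Po _) (b \Po _) (c \Po _) => a' b' c'; ring.
by rewrite poly5 !mul0r addr0 !decimD !decim_shift //= !add0r !addr0.
Qed.

Lemma pod_r3 m : (-1) ^+ (5 * m + 2) * (pod (5 * m + 2))%:R =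
  2%:R * (r3 (8 * m + 3))%:R :> F.
Proof.
set n := (5 * m + 2)%N; pose N := (20 * m + 20)%N; pose L := (2 * N.+1)%N.
pose G := podpoly F n; pose T := theta F L predT.
have GT : eqX n.+1 (G * T) 2%:R.
  rewrite /T theta_trisum -[_ *+ 2]mulr_natr mulrA -[X in eqX _ _ X]mul1r.
  by apply: eqXM (eqXX _ _); apply: podpoly_inverse; rewrite /n /N; lia.
have v2 : eqX m.+1 (decim 2 (T ^+ 4)) (T ^+ 4).
  rewrite decim_theta4 -[4%N]/(2 * 2)%N exprM; apply: eqXM;
    by apply/eqXP => i im; rewrite coef_decim coef_theta_gauss // /L /N; lia.
have GT5 : eqX n.+1 (G * (T \Po 'X^5)) (2%:R * T ^+ 4).
  by rewrite -theta_frobenius exprS mulrA; apply: eqXM GT (eqXX _ _).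
have dGT : eqX m.+1 (decim 2 G * T) (2%:R * T ^+ 4).
  have := eqX_decim GT5; rewrite decim_comp // => h; apply: eqX_trans h _.
  have -> : decim 2 (2%:R * T ^+ 4) = 2%:R * decim 2 (T ^+ 4).
    by rewrite -polyC_natr !mul_polyC decimZ.
  exact: eqXM (eqXX _ _) v2.
have dG : eqX m.+1 (decim 2 G) (2%:R * T ^+ 3).
  (* [T] is cancelled by multiplying by [G], as [G * T = 2]; both sides then carry a factor 2. *)
  apply: (@eqX_mulI _ _ 2%:R); first by rewrite -polyC_natr coefC.
  have GT' : eqX m.+1 (G * T) 2%:R by apply: eqX_le GT; rewrite /n; lia.
  apply: (@eqX_trans _ _ _ (G * (decim 2 G * T))).
    by rewrite mulrCA mulrC; apply: eqXM (eqXX _ _) _; apply: eqX_sym.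
  apply: (@eqX_trans _ _ _ (G * (2%:R * T ^+ 4))).
    exact: eqXM (eqXX _ _) dGT.
  have -> : G * (2%:R * T ^+ 4) = (G * T) * (2%:R * T ^+ 3) by ring.
  exact: eqXM GT' (eqXX _ _).
have /eqXP/(_ m (ltnSn m)) := dG.
rewrite coef_decim coef_podpoly -polyC_natr coefCM coef_theta3 //.
by rewrite /L /N; lia.
Qed.

End Mod5.

Lemma pod_dvd5 m : (5 %| r3 (8 * m + 3))%N -> (5 %| pod (5 * m + 2))%N.
Proof.
have ch : 5%N \in [pchar 'F_5] by exact: pchar_Fp.
rewrite !(dvdn_pcharf ch) => /eqP r0; have := pod_r3 m.
by rewrite r0 mulr0 => /eqP; rewrite mulf_eq0 signr_eq0.
Qed.

(** * Exponents for which 5 divides the geometric sum *)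

Lemma pod_pow p N k : prime p -> (3 <= p)%N -> ~~ (p %| N)%N ->
  p * N = 3 %[mod 8] -> (5 %| \sum_(i < k.+1) p ^ i)%N ->
  pod ((5 * p ^ (2 * k).+1 * N + 1) %/ 8) = 0 %[mod 5].
Proof.
move=> pp p3 pN m8 d5; have p_odd : odd p.
  by case: (even_prime pp) => // p2; rewrite p2 in p3.
(* As [p^2 = 1] modulo 8, the residue 3 of [p N] passes to every odd power of [p] times [N], and
   [5 (8m + 3) + 1 = 8 (5m + 2)] makes the division exact. *)
have p1 : (p ^ 2 = 1 %[mod 8])%N.
  have -> : (p ^ 2 = 4 * (p./2 * p./2.+1) + 1)%N by nia.
  by have : ~~ odd (p./2 * p./2.+1) by [rewrite oddM /=; case: odd]; lia.
have q3 : (p ^ (2 * k).+1 * N = 3 %[mod 8])%N.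
  rewrite expnSr -mulnA -modnMmr m8 modnMmr expnM -modnMml -modnXm p1 modnXm.
  by rewrite exp1n modnMml.
pose m := ((p ^ (2 * k).+1 * N) %/ 8)%N.
have em : (p ^ (2 * k).+1 * N = 8 * m + 3)%N by rewrite /m; lia.
have -> : ((5 * p ^ (2 * k).+1 * N + 1) %/ 8 = 5 * m + 2)%N by lia.
apply/eqP; rewrite mod0n; apply: pod_dvd5.
by rewrite -em r3_pow // dvdn_mulr.
Qed.

Lemma sum_pow_mod5_1 p k : p = 1 %[mod 5] -> (5 %| \sum_(i < 5 * k) p ^ i)%N.
Proof.
move=> p1; elim: k => [|k IH]; first by rewrite big_ord0.
rewrite mulnS addnC !addnS addn0 !big_ord_recr /= -!addnA dvdn_addr //.
have e i : (p ^ i = 1 %[mod 5])%N by rewrite -modnXm p1 modnXm exp1n.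
have := e (5 * k)%N; have := e (5 * k).+1; have := e (5 * k).+2.
have := e (5 * k).+3; have := e (5 * k).+4; lia.
Qed.

(** Fermat gives [5 | p^(4k) - 1], which is [p - 1] times the sum, and [p - 1] is prime to 5. *)
Lemma sum_pow_mod5 p k : (0 < p)%N -> (1 < p %% 5)%N ->
  (5 %| \sum_(i < 4 * k) p ^ i)%N.
Proof.
move=> p0 p5.
have p4 : (p ^ 4 = 1 %[mod 5])%N.
  rewrite -modnXm; have : (p %% 5 < 5)%N by rewrite ltn_mod.
  by case: (p %% 5)%N p5 => [|[|[|[|[|]]]]].
rewrite -(@Gauss_dvdr 5 p.-1); last by rewrite prime_coprime //; lia.
rewrite -predn_exp -subn1 -eqn_mod_dvd ?expn_gt0 ?p0 // expnM.
by rewrite -modnXm p4 modnXm exp1n.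
Qed.

Local Close Scope ring_scope.
Theorem theorem6 (p N alpha : nat)
    (hp : prime p) (hp3 : 3 <= p) (hN : 0 < N) (hpN : ~~ (p %| N))
    (hmod : p * N = 3 %[mod 8]) :
  (p = 1 %[mod 5] ->
     pod ((5 * p ^ (10 * alpha + 9) * N + 1) %/ 8) = 0 %[mod 5]) /\
  (p = 2 %[mod 5] \/ p = 3 %[mod 5] \/ p = 4 %[mod 5] ->
     pod ((5 * p ^ (8 * alpha + 7) * N + 1) %/ 8) = 0 %[mod 5]).
Proof.
split=> hp5.
  have -> : 10 * alpha + 9 = (2 * (5 * alpha + 4)).+1 by lia.
  apply: pod_pow => //; have -> : (5 * alpha + 4).+1 = 5 * alpha.+1 by lia.
  exact: sum_pow_mod5_1.
have -> : 8 * alpha + 7 = (2 * (4 * alpha + 3)).+1 by lia.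
apply: pod_pow => //; have -> : (4 * alpha + 3).+1 = 4 * alpha.+1 by lia.
by apply: sum_pow_mod5; lia.
Qed.
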